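(* Let $X\subset\mathbb{R}^2$ be a nonempty compact polytope with $n_v$ vertices, let $X_v$ be its vertex set, and let $n_f\in\mathbb{N}\cup\{\infty\}$ satisfy $n_f\ge n_v$. Run the Planar Algorithm (described in the context) with the oracle $\mathsf{D}(d)=\max_{v\in X}v^\top d$ and the bound $n_f$. (1) If $n_v=1$, then the algorithm terminates after the initialization step. (2) If $n_f=n_v$, then the algorithm terminates after at most $3n_v$ oracle calls. (3) If $n_f>n_v$, then the algorithm terminates after at most $3n_v+1$ oracle calls. In either case, the algorithm terminates with $S_v=X_v$.
   Context: The oracle $\mathsf{D}:\mathbb{R}^2\to\mathbb{R}$, $\mathsf{D}(d)=\max_{v\in X}v^\top d$, is the only access to $X$; an oracle call is one evaluation of $\mathsf{D}$. The algorithm also knows $n_f$, with $n_f=\infty$ meaning that no bound on the number of vertices is known. Notation: $\mathrm{e}_1,\mathrm{e}_2$ are the coordinate vectors; $L(d)=\{v\in\mathbb{R}^2: v^\top d=\mathsf{D}(d)\}$; for a finite set $E$ of directions, $\mathcal{H}(E)=\bigcap_{d\in E}\{v\in\mathbb{R}^2: v^\top d\le \mathsf{D}(d)\}$. For a polygon $P$, $P_v$ is its vertex set and $P_e=P\setminus(\mathrm{int}(P)\cup P_v)$ is its edge set. Planar Algorithm. Initialization: set $P=\mathcal{H}(E)$ with $E=\{\mathrm{e}_1,\mathrm{e}_2,-\mathrm{e}_1-\mathrm{e}_2\}$ (3 oracle calls). If $P$ is a singleton, set $S_v=P$ and terminate. Otherwise enumerate the 3 vertices of $P$ clockwise, $P_v=\{p^1,p^2,p^3\}$,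 and set $S_v=\emptyset$, $i=1$. While $P_v\ne S_v$ and $|S_v|<n_f$, do the following (throughout, $P=\mathrm{conv}(P_v)$, its vertices are enumerated clockwise, and indices are read modulo $|P_v|$). Set $a=p^i$, $b=p^{i+1}$, $c=p^{i+2}$. Choose any $d\in\mathbb{R}^2$ with $d^\top a=d^\top c<d^\top b$, and compute $\mathsf{D}(d)\in[d^\top a,d^\top b]$ (one oracle call). - If $\mathsf{D}(d)=d^\top b$: replace $S_v$ by $S_v\cup\{b\}$, leave $P_v$ unchanged, and replace $i$ by $i+1$. - If $\mathsf{D}(d)=d^\top a$: replace $S_v$ by $S_v\cup\{a,c\}$ and $P_v$ by $P_v\setminus\{b\}$, re-enumerate $P_v$ clockwise starting from $a$, which keeps index $i$ (so $c$ gets index $i+1$), and replace $i$ by $i+1$. - Otherwise ($d^\top a<\mathsf{D}(d)<d^\top b$): compute the two distinct points $\{b',c'\}=P_e\cap L(d)$, leave $S_v$ unchanged, replace $P_v$ by $(P_v\setminus\{b\})\cup\{b',c'\}$, re-enumerate $P_v$ clockwise starting from $a$, which keeps index $i$ (the two new points get indices $i+1,i+2$), and leave $i$ unchanged. Return $S_v$. *)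

(* Defs.v *)
From HB Require Import structures.
From mathcomp Require Import all_boot all_order all_algebra finmap.
From mathcomp Require Import all_classical all_reals all_analysis.
Import Order.TTheory GRing.Theory Num.Theory numFieldNormedType.Exports.

Set Implicit Arguments.
Unset Strict Implicit.
Unset Printing Implicit Defensive.


Local Open Scope classical_set_scope.
Local Open Scope ring_scope.

Section Geometry.
Variable R : realType.
Local Notation pt := 'cV[R]_2.

Definition dotp (u v : pt) : R := (u^T *m v) 0 0.

Definition conv_hull (A : set pt) : set pt := smallest (@convex_set R _) A.

Definition polytope (X : set pt) : Prop :=
  exists V : seq pt, X = conv_hull [set` V].

(* Vertices are extreme points. *)
Definition vertices (A : set pt) : set pt :=
  [set v | A v /\ forall (x y : pt) (t : R), A x -> A y -> 0 < t < 1 ->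
             v = t *: x + (1 - t) *: y -> x = y].

(* The union of the edges of a polygon, without their endpoints. *)
Definition edge_set (P : set pt) : set pt := P `\` (interior P `|` vertices P).

(* Twice the signed area of the triangle pqr: negative iff p, q, r turn
   clockwise. *)
Definition orient (p q r : pt) : R :=
  (q 0 0 - p 0 0) * (r 1 0 - p 1 0) - (q 1 0 - p 1 0) * (r 0 0 - p 0 0).

(* s lists, clockwise, the vertices of a convex polygon (possibly a segment
   or a point), starting from any of them. *)
Definition clockwise (s : seq pt) : Prop :=
  uniq s /\
  forall i j k : nat, (i < j < k)%N -> (k < size s)%N ->
    orient (nth 0 s i) (nth 0 s j) (nth 0 s k) < 0.

(* p^i, for the enumeration p^1, p^2, .. of s, the index (i >= 1) being read
   modulo |s|. *)
Definition point (s : seq pt) (i : nat) : pt := nth 0 s (i.-1 %% size s).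

Definition is_oracle (X : set pt) (D : pt -> R) : Prop :=
  forall d : pt, let values := [set dotp v d | v in X] in
    values (D d) /\ ubound values (D d).

Definition supp_line (D : pt -> R) (d : pt) : set pt :=
  [set v | dotp v d = D d].

Definition outer (D : pt -> R) (E : seq pt) : set pt :=
  \bigcap_(d in [set` E]) [set v | dotp v d <= D d].

Definition e1 : pt := delta_mx 0 0.
Definition e2 : pt := delta_mx 1 0.
Definition init_dirs : seq pt := [:: e1; e2; - e1 - e2].

End Geometry.

Arguments init_dirs {R}.

(* None stands for infinity. *)
Definition bound_ge (nf : option nat) (n : nat) : bool :=
  if nf is Some m then (n <= m)%N else true.
Definition bound_gt (nf : option nat) (n : nat) : bool :=
  if nf is Some m then (n < m)%N else true.

Section Algorithm.
Variable R : realType.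
Local Notation pt := 'cV[R]_2.

(* s is the current clockwise enumeration of P_v, S is S_v, and k counts the
   oracle calls made so far.
   [Start]           the initialization has not been executed yet;
   [Loop s i S k]    the loop condition is about to be tested;
   [Query s i S d k] the direction d has been chosen and D(d) computed;
   [Halt S k]        S has been returned. *)
Inductive state :=
| Start
| Loop of seq pt & nat & {fset pt} & nat
| Query of seq pt & nat & {fset pt} & pt & nat
| Halt of {fset pt} & nat.

Variables (D : pt -> R) (nf : option nat).

Definition loop_guard (s : seq pt) (S : {fset pt}) : bool :=
  ([fset x in s]%fset != S) && bound_gt nf #|` S|.

Inductive step : state -> state -> Prop :=
| step_init_point p :
    outer D init_dirs = [set p] ->
    step Start (Halt [fset p]%fset (size (@init_dirs R)))
| step_init_triangle s :
    (~ exists p, outer D init_dirs = [set p]) ->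
    size s = 3%N -> clockwise s -> [set` s] = vertices (outer D init_dirs) ->
    step Start (Loop s 1 fset0 (size (@init_dirs R)))
| step_exit s i S k :
    ~~ loop_guard s S ->
    step (Loop s i S k) (Halt S k)
| step_query s i S k d :
    loop_guard s S ->
    dotp d (point s i) = dotp d (point s i.+2) ->
    dotp d (point s i) < dotp d (point s i.+1) ->
    step (Loop s i S k) (Query s i S d k.+1)
| step_vertex s i S d k :
    D d = dotp d (point s i.+1) ->
    step (Query s i S d k) (Loop s i.+1 (S `|` [fset point s i.+1])%fset k)
| step_delete s i S d k s' :
    D d = dotp d (point s i) ->
    [fset x in s']%fset = ([fset x in s] `\ point s i.+1)%fset ->
    clockwise s' -> point s' i = point s i ->
    step (Query s i S d k)
         (Loop s' i.+1 (S `|` [fset point s i; point s i.+2])%fset k)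
| step_cut s i S d k b' c' s' :
    dotp d (point s i) < D d < dotp d (point s i.+1) ->
    b' != c' ->
    [set b'; c'] = edge_set (conv_hull [set` s]) `&` supp_line D d ->
    [fset x in s']%fset =
      (([fset x in s] `\ point s i.+1) `|` [fset b'; c'])%fset ->
    clockwise s' -> point s' i = point s i ->
    step (Query s i S d k) (Loop s' i S k).

(* Whatever choices are made, the execution from the given state is finite,
   is never blocked, and returns a set S after a total number k of oracle
   calls with Q S k. *)
Inductive halts_with (Q : {fset pt} -> nat -> Prop) : state -> Prop :=
| halts_now S k : Q S k -> halts_with Q (Halt S k)
| halts_later st :
    (exists st', step st st') ->
    (forall st', step st st' -> halts_with Q st') ->
    halts_with Q st.

Definition halts_at_init : Prop :=
  (exists st, step Start st) /\
  forall st, step Start st -> exists S k, st = Halt S k.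

End Algorithm.

Arguments Start {R}.

(* Main.v *)
Require Import Defs.
From HB Require Import structures.
From mathcomp Require Import all_boot all_order all_algebra finmap.
From mathcomp Require Import all_classical all_reals all_analysis.
From mathcomp Require Import ring lra zify.
Import Order.TTheory GRing.Theory Num.Theory numFieldNormedType.Exports.

Set Implicit Arguments.
Unset Strict Implicit.
Unset Printing Implicit Defensive.

Local Open Scope classical_set_scope.
Local Open Scope card_scope.
Local Open Scope ring_scope.

(** Why the algorithm finds the vertices of X, with so few oracle calls.

    The polygon P always contains X and every edge of P contains a vertex of
    X.  Both hold for the initial triangle, whose sides lie on supporting
    lines of X ([triangle_invariant]).  The direction d of a query is
    orthogonal to the diagonal ac, so only the ear a, b, c of P matters
    ([ear]).  If D(d) = d.b then b is a vertex of X, because b is the only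
    point of P at that height.  If D(d) = d.a then X lies below the diagonal;
    as the edges ab and bc meet X, both a and c are vertices of X, and the ear
    can be removed.  Otherwise the tip of the ear is cut off along L(d), and
    L(d) supports X, so that the new edge contains a vertex of X too.  These
    are [invariant_vertex], [invariant_delete] and [invariant_cut]; the last
    two rest on [ear_cut], which says that what remains of the hull of b
    and A below a line at or above the diagonal lies in the hull of A and of
    the two points where that line cuts the sides of the ear.

    Read the N vertices of P clockwise from b = p^(i+1) to a = p^i.  The
    vertices in S come last, say after r unconfirmed ones ([loop_invariant]):
    a query confirms or removes the first vertex, or replaces it by two
    unconfirmed ones, and a vertex that is confirmed moves to the end.  The
    edges joining the 1st and 2nd, the 3rd and 4th, ... unconfirmed vertices
    are disjoint, avoid S, and contain a vertex of X each, whence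
    N - r + floor(r / 2) <= nv ([inv_count]).

    A query changes (N, r) as follows: a confirmation into (N, r - 1), a
    deletion into (N - 1, r - 2), a cut into (N + 1, r + 1).  In each case
    3 nv + 2 r - 3 N decreases, by 2 for a confirmation and by 1 otherwise,
    and it is bounded below by [inv_count], so the execution is finite.  Two
    kinds of deletion differ.  If no vertex is confirmed yet (r = N), a
    deletion confirms a and c at once and leads to r - 3; hence the first
    query that is not a cut saves one call.  If b is the last unconfirmed
    vertex (r = 1), its deletion leads to r = 0, and one call more than the
    potential predicts is made; then S was already the set of all vertices of
    X, so this happens only if the bound nf exceeds nv.  That is the extra
    call in 3 nv + 1.  The inequality that every state satisfies is [budget].

    The algorithm stops when r = 0, and then X is the hull of S, or when S has
    at least nf >= nv elements; S consists of vertices of X, so S is the whole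
    vertex set in both cases ([exit_outcome]). *)

(** * Segments, convex hulls and orientation in the plane *)

Section Hull.
Variable R : realType.
Local Notation pt := 'cV[R]_2.
Implicit Types (a b c d p q x y z v : pt) (A B : set pt).

Lemma pt_eq p q : p 0 0 = q 0 0 -> p 1 0 = q 1 0 -> p = q.
Proof.
move=> h0 h1; apply/matrixP => i j; rewrite !ord1.
case: i => [[|[|//]] lti].
- by rewrite (_ : Ordinal lti = 0)//; apply/val_inj.
- by rewrite (_ : Ordinal lti = 1)//; apply/val_inj.
Qed.

Lemma dotpE p q : dotp p q = p 0 0 * q 0 0 + p 1 0 * q 1 0.
Proof.
rewrite /dotp mxE !big_ord_recl big_ord0 addr0 !mxE.
by rewrite (_ : lift ord0 ord0 = 1)//; apply/val_inj.
Qed.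

Lemma dotpC p q : dotp p q = dotp q p.
Proof. by rewrite !dotpE; ring. Qed.

Definition segment p q : set pt :=
  [set z | exists2 t : R, 0 <= t <= 1 & z = t *: p + (1 - t) *: q].

Lemma segmentC p q z : segment p q z -> segment q p z.
Proof.
move=> [t t01 ->]; exists (1 - t); first by lra.
by rewrite addrC opprB addrCA subrr addr0.
Qed.

Lemma segmentl p q : segment p q p.
Proof. by exists 1; [lra|rewrite subrr scale1r scale0r addr0]. Qed.

Lemma segmentr p q : segment p q q.
Proof. exact/segmentC/segmentl. Qed.

Lemma convex_segment A :
  convex_set A <-> forall x y, A x -> A y -> segment x y `<=` A.
Proof.
split=> [cA x y Ax Ay _ [t /andP[t0 t1] ->]|cA x y t].
  have := cA x y (Itv01 t0 t1); rewrite !in_setE; exact.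
rewrite !in_setE => Ax Ay; apply: (cA x y) => //.
by exists t%:inum; first by apply/andP; split.
Qed.

Lemma conv_hull_sub A : A `<=` conv_hull A.
Proof. exact: sub_gen_smallest. Qed.

Lemma conv_hull_min A B : convex_set B -> A `<=` B -> conv_hull A `<=` B.
Proof. by move=> cB AB; exact: smallest_sub. Qed.

Lemma conv_hull_convex A : convex_set (conv_hull A).
Proof.
apply/convex_segment => x y Ax Ay z xyz B [cB AB].
by have /convex_segment := cB; apply; [exact: Ax|exact: Ay|exact: xyz].
Qed.

Lemma conv_hull_segment A x y :
  conv_hull A x -> conv_hull A y -> segment x y `<=` conv_hull A.
Proof. by have /convex_segment := @conv_hull_convex A; apply. Qed.

Lemma conv_hull_mono A B : A `<=` B -> conv_hull A `<=` conv_hull B.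
Proof.
move=> AB; apply: conv_hull_min; first exact: conv_hull_convex.
by apply: subset_trans AB _; exact: conv_hull_sub.
Qed.

Definition affine (f : pt -> R) :=
  forall x y (t : R), f (t *: x + (1 - t) *: y) = t * f x + (1 - t) * f y.

Lemma affine_dotp d : affine (dotp d).
Proof. by move=> x y t; rewrite !dotpE !mxE; ring. Qed.

Lemma affine_orient p q : affine (orient p q).
Proof. by move=> x y t; rewrite /orient !mxE; ring. Qed.

Lemma orientC p q x : orient p q x = orient q x p.
Proof. by rewrite /orient; ring. Qed.

Lemma orient_flip p q x : orient p x q = - orient p q x.
Proof. by rewrite /orient; ring. Qed.

Lemma orientl p q : orient p p q = 0.
Proof. by rewrite /orient; ring. Qed.

Lemma orientr p q : orient p q q = 0.
Proof. by rewrite /orient; ring. Qed.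

Lemma orientx p q : orient p q p = 0.
Proof. by rewrite /orient; ring. Qed.

Lemma affine_segment_le f x y z (r : R) : affine f ->
  segment x y z -> f x <= r -> f y <= r -> f z <= r.
Proof. by move=> fA [t t01 ->]; rewrite fA => fx fy; nra. Qed.

Lemma affine_segment_lt f x y z (r : R) : affine f ->
  segment x y z -> f x < r -> f y < r -> f z < r.
Proof.
move=> fA [t t01 ->]; rewrite fA => fx fy.
have : 0 < t \/ 0 < 1 - t by lra.
by case=> ?; nra.
Qed.

Lemma affine_segment_ge f x y z (r : R) : affine f ->
  segment x y z -> r <= f x -> r <= f y -> r <= f z.
Proof. by move=> fA [t t01 ->]; rewrite fA => fx fy; nra. Qed.

Lemma affine_hull_le f A (r : R) : affine f ->
  (forall x, A x -> f x <= r) -> forall x, conv_hull A x -> f x <= r.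
Proof.
move=> fA fle; apply: (@conv_hull_min A [set x | f x <= r]) => //.
by apply/convex_segment => x y fx fy z xyz; exact: affine_segment_le xyz fx fy.
Qed.

Lemma affine_hull_lt f A (r : R) : affine f ->
  (forall x, A x -> f x < r) -> forall x, conv_hull A x -> f x < r.
Proof.
move=> fA flt; apply: (@conv_hull_min A [set x | f x < r]) => //.
by apply/convex_segment => x y fx fy z xyz; exact: affine_segment_lt xyz fx fy.
Qed.

(** Removing an extreme point from a convex set leaves a convex set, which could
    not contain the hull of A if v were outside A. *)
Lemma vertex_generator A B v : convex_set B -> A `<=` B ->
  vertices B v -> conv_hull A v -> A v.
Proof.
move=> /convex_segment cB AB [Bv ext] Av; apply: contrapT => NAv.
suff: conv_hull A `<=` B `\ v by move/(_ v Av) => -[_]; apply.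
apply: conv_hull_min => [|x Ax]; last first.
  by split; [exact: AB|move=> /= xv; apply: NAv; rewrite -xv].
apply/convex_segment => x y [Bx xv] [By yv] z xyz; split.
  exact: cB xyz.
move=> /= zv; case: xyz => t /andP[t0 t1].
have [->|tn0] := eqVneq t 0.
  by rewrite scale0r subr0 scale1r add0r zv => vy; exact: yv.
have [->|tn1] := eqVneq t 1.
  by rewrite scale1r subrr scale0r addr0 zv => vx; exact: xv.
move=> ztxy; have xy : x = y.
  apply: (ext x y t) => //; last by rewrite -zv.
  by rewrite !lt_neqAle t0 t1 tn1 eq_sym tn0.
apply: xv; rewrite -zv ztxy -xy -scalerDl addrCA subrr addr0 scale1r//.
Qed.

(** The union of the segments from b to the hull of A is itself convex. *)
Lemma conv_hull_cone A b z : A !=set0 -> conv_hull (b |` A) z ->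
  exists2 y, conv_hull A y & segment b y z.
Proof.
move=> [a0 Aa0].
pose J := [set z | exists2 y, conv_hull A y & segment b y z].
suff /(_ z) : conv_hull (b |` A) `<=` J by [].
apply: conv_hull_min => [|x [->|Ax]]; last 2 first.
- by exists a0; [exact: conv_hull_sub|exact: segmentl].
- by exists x; [exact: conv_hull_sub|exact: segmentr].
apply/convex_segment => x y [x' Ax' [l l01 ->]] [y' Ay' [m m01 ->]].
move=> w [t t01 ->].
pose mu := t * (1 - l) + (1 - t) * (1 - m).
have t1l : 0 <= t * (1 - l) by nra.
have t1m : 0 <= (1 - t) * (1 - m) by nra.
(* mu is the total weight of the points x' and y' in w. *)
have [mu0|mu0] := eqVneq mu 0.
  have tl0 : t * (1 - l) = 0 by rewrite /mu in mu0; lra.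
  have tm0 : (1 - t) * (1 - m) = 0 by rewrite /mu in mu0; lra.
  exists x' => //; exists 1; first by lra.
  rewrite !scalerDr !scalerA tl0 tm0 subrr !scale0r !addr0 -scalerDl.
  by congr (_ *: _); lra.
have mugt0 : 0 < mu by rewrite lt_neqAle eq_sym mu0 /mu; lra.
exists ((t * (1 - l) / mu) *: x' + (1 - t * (1 - l) / mu) *: y').
  apply: (conv_hull_segment Ax' Ay'); exists (t * (1 - l) / mu) => //.
  apply/andP; split; first by rewrite divr_ge0// ltW.
  by rewrite ler_pdivrMr// mul1r /mu; lra.
exists (t * l + (1 - t) * m); first by rewrite /mu in mugt0; nra.
rewrite -[1 - (t * l + _)](_ : mu = _); last by rewrite /mu; lra.
have muE : mu * (t * (1 - l) / mu) = t * (1 - l) by field.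
have muE' : mu * (1 - t * (1 - l) / mu) = (1 - t) * (1 - m).
  by rewrite mulrBr muE mulr1 /mu; lra.
rewrite [mu *: _]scalerDr !scalerDr !scalerA muE muE' scalerDl.
by rewrite addrACA.
Qed.

Lemma conv_hull3 A a b c (r1 r2 r3 : R) : A a -> A b -> A c ->
  0 <= r1 -> 0 <= r2 -> 0 <= r3 -> r1 + r2 + r3 = 1 ->
  conv_hull A (r1 *: a + r2 *: b + r3 *: c).
Proof.
move=> Aa Ab Ac h1 h2 h3 h.
have [r31|r31] := eqVneq r3 1.
  have [-> ->] : r1 = 0 /\ r2 = 0 by split; lra.
  by rewrite r31 !scale0r !add0r scale1r; exact: conv_hull_sub.
have r3lt : 0 < 1 - r3 by move: r31 => /eqP; lra.
pose p := (r1 / (1 - r3)) *: a + (1 - r1 / (1 - r3)) *: b.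
apply: (@conv_hull_segment A p c).
- apply: (@conv_hull_segment A a b); [exact: conv_hull_sub..|].
  exists (r1 / (1 - r3)) => //.
  apply/andP; split; first by rewrite divr_ge0// ltW.
  by rewrite ler_pdivrMr// mul1r; lra.
- exact: conv_hull_sub.
- exists (1 - r3); first by lra.
  have E : (1 - r3) * (r1 / (1 - r3)) = r1 by field; lra.
  have E' : (1 - r3) * (1 - r1 / (1 - r3)) = r2 by rewrite mulrBr E; lra.
  by rewrite scalerDr !scalerA E E' opprB addrCA subrr addr0.
Qed.

(** The coefficients are ratios of signed areas, so that their signs can be read
    off three orientations. *)
Lemma barycentric a b c z : orient a b c != 0 ->
  z = (orient b c z / orient a b c) *: a + (orient c a z / orient a b c) *: b +
      (orient a b z / orient a b c) *: c.
Proof. by move=> h; apply: pt_eq; rewrite !mxE /orient in h *; field. Qed.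

Lemma sum_barycentric a b c z : orient a b c != 0 ->
  orient b c z / orient a b c + orient c a z / orient a b c +
  orient a b z / orient a b c = 1.
Proof. by move=> h; rewrite /orient in h *; field. Qed.

Lemma triangle_hull A a b c z : A a -> A b -> A c -> orient a b c < 0 ->
  orient a b z <= 0 -> orient b c z <= 0 -> orient c a z <= 0 ->
  conv_hull A z.
Proof.
move=> Aa Ab Ac abc abz bcz caz.
have abc0 : orient a b c != 0 by rewrite lt_eqF.
rewrite (barycentric z abc0); apply: conv_hull3 => //.
- by rewrite ler_ndivlMr// mul0r.
- by rewrite ler_ndivlMr// mul0r.
- by rewrite ler_ndivlMr// mul0r.
- exact: sum_barycentric.
Qed.

Lemma interior_direction A x v : interior A x ->
  exists2 t : R, 0 < t & A (x + t *: v).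
Proof.
move=> Ax.
have cont : (x + t *: v) @[t --> (0 : R)] --> x.
  suff: (x + t *: v) @[t --> (0 : R)] --> x + 0 *: v.
    by rewrite scale0r addr0.
  apply: cvgD; first exact: cvg_cst.
  by apply: cvgZ; [exact: cvg_id|exact: cvg_cst].
have near0 : \forall t \near (0 : R)^'+, A (x + t *: v).
  exact: (cvg_at_right_filter cont Ax).
near ((0 : R)^'+) => t.
exists t; first by near: t; exact: nbhs_right_gt.
by near: t.
Unshelve. all: by end_near.
Qed.

Lemma continuous_orient p q : continuous (orient p q : pt -> R).
Proof.
move=> z; rewrite /orient.
have cvgc i (r : R) : (fun w : pt => w i 0 - r : R) @ z --> z i 0 - r.
  apply: (@cvgB R R^o _ (nbhs z) _ (fun w : pt => w i 0) (fun=> r)).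
    exact: coord_continuous.
  exact: cvg_cst.
have cvgcM i (r r' : R) :
    (fun w : pt => r' * (w i 0 - r) : R) @ z --> r' * (z i 0 - r).
  apply: (@cvgM R pt (nbhs z) _ (fun=> r')); last exact: cvgc.
  exact: cvg_cst.
exact: (@cvgB R R^o _ (nbhs z) _ _ _ _ _
  (cvgcM 1 (p 1 0) _) (cvgcM 0 (p 0 0) _)).
Qed.

Lemma triangle_interior A a b c z : A a -> A b -> A c -> orient a b c < 0 ->
  orient a b z < 0 -> orient b c z < 0 -> orient c a z < 0 ->
  interior (conv_hull A) z.
Proof.
move=> Aa Ab Ac abc abz bcz caz.
have nb p q : orient p q z < 0 -> \forall w \near z, orient p q w < 0.
  move=> lt0; exact: (@continuous_orient p q z [set r | r < 0] (lt_nbhsl lt0)).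
near=> w; apply: (triangle_hull Aa Ab Ac abc); apply: ltW; near: w; exact: nb.
Unshelve. all: by end_near.
Qed.

(** Stepping from z away from v crosses the line pq into the forbidden side. *)
Lemma side_not_interior A p q v z : (forall x, A x -> orient p q x <= 0) ->
  orient p q v < 0 -> orient p q z = 0 -> ~ interior A z.
Proof.
move=> le0 pqv pqz /(@interior_direction _ _ (z - v))[t t0 /le0].
have -> : orient p q (z + t *: (z - v)) =
    orient p q z + t * (orient p q z - orient p q v).
  by rewrite /orient !mxE; ring.
by rewrite pqz; nra.
Qed.

Lemma between_not_vertex A p q t : p != q -> 0 < t < 1 -> A p -> A q ->
  ~ vertices A (t *: p + (1 - t) *: q).
Proof.
move=> /eqP pq t01 Ap Aq [_ ext]; apply: pq.
exact: (ext p q t Ap Aq t01).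
Qed.

End Hull.

(** * Ears of a convex polygon *)

Section Ear.
Variable R : realType.
Local Notation pt := 'cV[R]_2.

(** The part of a convex polygon with consecutive vertices a, b, c that a query
    sees: A is the set of the vertices other than b, and d is orthogonal to the
    diagonal ac, with the tip b higher than the diagonal in direction d. *)
Record ear (a b c d : pt) (A : set pt) : Prop := Ear {
  ear_turn : orient a b c < 0;
  ear_left : A a;
  ear_right : A c;
  ear_side : forall z, A z ->
    [/\ orient a b z <= 0, orient b c z <= 0 & orient a c z <= 0];
  ear_base : dotp d a = dotp d c;
  ear_up : dotp d a < dotp d b }.

Variables (a b c d : pt) (A : set pt).
Hypothesis earA : ear a b c d A.

Local Notation P := (conv_hull (b |` A)).

(** Heights in direction d are, up to a positive factor, signed distances to the
    diagonal ac. *)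
Lemma ear_le z : A z -> dotp d z <= dotp d a.
Proof.
have [abc Aa Ac side dac dab] := earA.
move=> /side[_ _ acz].
have acb : 0 < orient a c b by rewrite orient_flip oppr_gt0.
have E : orient a c z * (dotp d b - dotp d a) =
         orient a c b * (dotp d z - dotp d a) +
         (dotp d c - dotp d a) * orient a b z.
  by rewrite /orient !dotpE; ring.
rewrite -dac subrr mul0r addr0 in E.
by nra.
Qed.

Lemma ear_hull_le z : conv_hull A z -> dotp d z <= dotp d a.
Proof. exact: (affine_hull_le (affine_dotp d) ear_le). Qed.

Lemma ear_cone z : P z -> exists2 y, conv_hull A y & segment b y z.
Proof. by apply: conv_hull_cone; exists a; exact: ear_left earA. Qed.

Lemma ear_tip_le z : P z -> dotp d z <= dotp d b.
Proof.
have [abc Aa Ac side dac dab] := earA.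
case/ear_cone => y /ear_hull_le ya /affine_segment_le.
by apply; [exact: affine_dotp| |]; lra.
Qed.

Lemma ear_tip z : P z -> dotp d z = dotp d b -> z = b.
Proof.
have [abc Aa Ac side dac dab] := earA.
case/ear_cone => y /ear_hull_le ya [t t01 ->]; rewrite affine_dotp => E.
have -> : t = 1 by nra.
by rewrite subrr scale0r scale1r addr0.
Qed.

(** The hull lies in the angle of the ear, which confines its points above the
    diagonal to the triangle abc. *)
Lemma ear_sides z : P z -> orient a b z <= 0 /\ orient b c z <= 0.
Proof.
have [abc Aa Ac side dac dab] := earA.
move=> Pz; split; apply: (affine_hull_le (affine_orient _ _) _ Pz).
- by move=> x [->|/side[]//]; rewrite orientr.
- by move=> x [->|/side[]//]; rewrite orientx.
Qed.

Lemma ear_tip_hull : P b.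
Proof. by apply: conv_hull_sub; left. Qed.

Lemma ear_base_hull : P a /\ P c.
Proof.
split; apply: conv_hull_sub; right; first exact: ear_left earA.
exact: ear_right earA.
Qed.

Section Cut.
Variable r : R.
Hypothesis r01 : 0 <= r < 1.
Local Notation b' := (r *: b + (1 - r) *: a).
Local Notation c' := (r *: b + (1 - r) *: c).
Local Notation delta := (r * dotp d b + (1 - r) * dotp d a).

(** In barycentric coordinates with respect to a, b, c, the height fixes the
    coefficient of b, here equal to r. *)
Lemma ear_cut_line z : P z -> dotp d z = delta -> segment b' c' z.
Proof.
have [abc Aa Ac side dac dab] := earA; have hr := r01.
move=> Pz dz; have [abz bcz] := ear_sides Pz.
have abc0 : orient a b c != 0 by rewrite lt_eqF.
have zE := barycentric z abc0.
have sumE := sum_barycentric z abc0.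
set r1 := _ / _ in zE sumE; set r2 := orient c a z / _ in zE sumE.
set r3 := orient a b z / _ in zE sumE.
have r10 : 0 <= r1 by rewrite ler_ndivlMr// mul0r.
have r30 : 0 <= r3 by rewrite ler_ndivlMr// mul0r.
(* The height of z above the diagonal is r2 times that of b. *)
have r2r : r2 = r.
  have : dotp d z = r1 * dotp d a + r2 * dotp d b + r3 * dotp d c.
    by rewrite zE !dotpE !mxE; ring.
  by rewrite dz -dac; nra.
have r1r : 0 < 1 - r by lra.
exists (r1 / (1 - r)).
  apply/andP; split; first by rewrite divr_ge0// ltW.
  by rewrite ler_pdivrMr// mul1r; lra.
have r3E : r3 = 1 - r - r1 by lra.
rewrite zE r2r r3E; apply: pt_eq; rewrite !mxE; field; lra.
Qed.

(** Write x on a segment from b to a point y of the hull of A.  That segment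
    crosses the cutting line at a point z of the segment b'c', and x lies
    between y and z.  For r = 0 the line is the diagonal ac itself. *)
Lemma ear_cut x : P x -> dotp d x <= delta ->
  conv_hull ([set b'; c'] `|` A) x.
Proof.
have [abc Aa Ac side dac dab] := earA; have hr := r01.
move=> /ear_cone[y Ay [l l01 xE]] dx.
have dy := ear_hull_le Ay.
have Py : P y by apply: conv_hull_mono Ay => w; right.
(* k is the position on the segment from y to b of the cutting line. *)
pose k := (delta - dotp d y) / (dotp d b - dotp d y).
have dby : 0 < dotp d b - dotp d y by lra.
have kE : k * (dotp d b - dotp d y) = delta - dotp d y.
  by rewrite /k; field; lra.
have k01 : 0 <= k < 1 by nra.
have lk : l <= k by rewrite xE affine_dotp in dx; nra.
have Ay' : conv_hull ([set b'; c'] `|` A) y.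
  by apply: conv_hull_mono Ay => w; right.
have [k0|k0] := eqVneq k 0.
  have l0 : l = 0 by lra.
  by rewrite xE l0 scale0r subr0 scale1r add0r.
pose z := k *: b + (1 - k) *: y.
have Pz : P z.
  by apply: (conv_hull_segment ear_tip_hull Py); exists k; first lra.
have bcz : segment b' c' z.
  by apply: ear_cut_line Pz _; rewrite /z affine_dotp; lra.
have hz : conv_hull ([set b'; c'] `|` A) z.
  apply: conv_hull_segment bcz; apply: conv_hull_sub; left; [by left|by right].
have kgt0 : 0 < k by rewrite lt_neqAle eq_sym k0; lra.
apply: (conv_hull_segment hz Ay'); exists (l / k).
  apply/andP; split; first by rewrite divr_ge0//; lra.
  by rewrite ler_pdivrMr// mul1r.
by rewrite xE /z; apply: pt_eq; rewrite !mxE; field; lra.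
Qed.

Lemma ear_cut_points : P b' /\ P c'.
Proof.
have [abc Aa Ac side dac dab] := earA; have hr := r01.
have [Pa Pc] := ear_base_hull.
split; [apply: (conv_hull_segment ear_tip_hull Pa)|
        apply: (conv_hull_segment ear_tip_hull Pc)]; exists r => //; lra.
Qed.

Lemma ear_interior z : orient a b z < 0 -> orient b c z < 0 ->
  dotp d a < dotp d z -> interior P z.
Proof.
have [abc Aa Ac side dac dab] := earA; have hr := r01.
move=> abz bcz daz.
apply: (@triangle_interior _ _ a b c) => //; [by right|by left|by right|].
have E : orient c a z * (dotp d b - dotp d a) =
         orient a b c * (dotp d z - dotp d a) +
         (dotp d c - dotp d a) * orient a z b.
  by rewrite /orient !dotpE; ring.
rewrite -dac subrr mul0r addr0 in E.
by nra.
Qed.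

(** Strictly between the two cut points the line runs inside the triangle abc,
    hence in the interior; the cut points themselves are on a side of the
    polygon, but strictly between its endpoints. *)
Lemma ear_edge_set : 0 < r ->
  edge_set P `&` [set v | dotp v d = delta] = [set b'; c'].
Proof.
have [abc Aa Ac side dac dab] := earA; have hr := r01.
move=> r0; have rlt1 : 0 < 1 - r by lra.
have ba : b != a by apply/eqP => E; move: dab; rewrite -E ltxx.
have bc : b != c by apply/eqP => E; move: dab; rewrite dac E ltxx.
have [Pb' Pc'] := ear_cut_points; have [Pa Pc] := ear_base_hull.
have r01' : 0 < r < 1 by lra.
apply/seteqP; split => z /=.
- move=> [[Pz]] /not_orP[notint _]; rewrite dotpC => dz.
  have [t t01 zE] := ear_cut_line Pz dz.
  have [t1|tn1] := eqVneq t 1.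
    by left; rewrite zE t1 subrr scale0r scale1r addr0.
  have [t0|tn0] := eqVneq t 0.
    by right; rewrite zE t0 subr0 scale0r scale1r add0r.
  have tgt0 : 0 < t by rewrite lt_neqAle eq_sym tn0; lra.
  have tlt1 : t < 1 by rewrite lt_neqAle tn1; lra.
  case: notint; apply: ear_interior; last by rewrite dz; nra.
    rewrite zE !affine_orient orientr orientx.
    have : 0 < (1 - t) * (1 - r) by nra.
    by nra.
  rewrite zE !affine_orient orientr orientx -orientC.
  have : 0 < t * (1 - r) by nra.
  by nra.
- move=> [] ->; (split; last by rewrite dotpC affine_dotp -?dac).
    split=> // -[|]; last exact: (between_not_vertex ba r01' ear_tip_hull Pa).
    apply: (@side_not_interior _ P a b c) => //.
      by move=> x /ear_sides[].
    by rewrite affine_orient orientr orientx; lra.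
  split=> // -[|]; last exact: (between_not_vertex bc r01' ear_tip_hull Pc).
  apply: (@side_not_interior _ P b c a) => //.
  - by move=> x /ear_sides[].
  - by rewrite -orientC.
  - by rewrite affine_orient orientr orientx; lra.
Qed.

End Cut.
End Ear.

(** * Vertices of a polytope as maximisers *)

Section Lex.
Variable R : realType.
Local Notation pt := 'cV[R]_2.
Implicit Types (d p q x y z v : pt).

Definition rot90 d : pt := d 0 0 *: @e2 R - d 1 0 *: @e1 R.

Lemma dotp_rot90 d p : dotp (rot90 d) p = d 0 0 * p 1 0 - d 1 0 * p 0 0.
Proof. by rewrite /rot90 /e1 /e2 dotpE !mxE/=; ring. Qed.

(** Comparison by height in direction d, ties being broken along the orthogonal
    direction, so that a maximum is unique. *)
Definition lexle d x y :=
  dotp d x < dotp d y \/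
  (dotp d x = dotp d y /\ dotp (rot90 d) x <= dotp (rot90 d) y).

Lemma lexle_total d x y : lexle d x y \/ lexle d y x.
Proof. rewrite /lexle; lra. Qed.

Lemma lexmax d (s : seq pt) : s != [::] ->
  exists2 v, v \in s & forall x, x \in s -> lexle d x v.
Proof.
elim: s => // x s IHs _; have [->|/IHs[v vs vmax]] := eqVneq s [::].
  exists x; rewrite ?mem_head// => y; rewrite inE => /eqP ->.
  by right; split.
have [xv|vx] := lexle_total d x v.
  exists v; first by rewrite inE vs orbT.
  by move=> y; rewrite inE => /predU1P[->//|]; exact: vmax.
exists x; first exact: mem_head.
move=> y; rewrite inE => /predU1P[->|/vmax]; first by right; split.
by move: vx; rewrite /lexle; lra.
Qed.

Lemma dotp_rot90_inj d x y : d != 0 -> dotp d x = dotp d y ->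
  dotp (rot90 d) x = dotp (rot90 d) y -> x = y.
Proof.
move=> d0 h1 h2.
have nz : d 0 0 * d 0 0 + d 1 0 * d 1 0 != 0.
  apply: contra d0 => /eqP E; apply/eqP.
  have [E0 E1] : d 0 0 * d 0 0 = 0 /\ d 1 0 * d 1 0 = 0 by nra.
  by apply: pt_eq; rewrite mxE; apply/eqP;
    rewrite -[_ == 0]orbb -mulf_eq0 ?E0 ?E1.
rewrite !dotp_rot90 !dotpE in h1 h2.
apply: pt_eq; apply: (mulfI nz).
- transitivity (d 0 0 * (d 0 0 * x 0 0 + d 1 0 * x 1 0) -
                d 1 0 * (d 0 0 * x 1 0 - d 1 0 * x 0 0)); first by ring.
  by rewrite h1 h2; ring.
- transitivity (d 1 0 * (d 0 0 * x 0 0 + d 1 0 * x 1 0) +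
                d 0 0 * (d 0 0 * x 1 0 - d 1 0 * x 0 0)); first by ring.
  by rewrite h1 h2; ring.
Qed.

(** A lexicographic maximum over the generators is one over the whole hull,
    since the points below it form a convex set, and it is extreme because
    there is no other. *)
Lemma vertex_max (X : set pt) d : polytope X -> X !=set0 -> d != 0 ->
  exists2 v, vertices X v & forall x, X x -> dotp d x <= dotp d v.
Proof.
move=> [s ->] [x0 Xx0] d0.
have s0 : s != [::].
  apply/eqP => s0; suff: conv_hull [set` s] `<=` set0 by move/(_ x0 Xx0).
  apply: conv_hull_min; last by rewrite s0.
  by apply/convex_segment.
have [v vs vmax] := lexmax d s0.
have lexX : conv_hull [set` s] `<=` [set x | lexle d x v].
  apply: conv_hull_min; last exact: vmax.
  apply/convex_segment => x y /= xv yv z [t t01 ->].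
  rewrite /= /lexle !affine_dotp.
  have [t0|tn0] := eqVneq t 0.
    by rewrite t0 subr0 !mul0r !mul1r !add0r.
  have [t1|tn1] := eqVneq t 1.
    by rewrite t1 subrr !mul0r !mul1r !addr0.
  have tgt0 : 0 < t by rewrite lt_neqAle eq_sym tn0; lra.
  have tlt1 : t < 1 by rewrite lt_neqAle tn1; lra.
  case: xv => [xv|[xv xv']].
    by left; case: yv => [yv|[yv _]]; nra.
  case: yv => [yv|[yv yv']]; first by left; nra.
  by right; split; nra.
exists v; last by move=> x /lexX[/ltW//|[->]].
split=> [|x y t Xx Xy t01 vE]; first exact: conv_hull_sub.
have dv : dotp d v = t * dotp d x + (1 - t) * dotp d y.
  by rewrite {1}vE affine_dotp.
have dv' : dotp (rot90 d) v =
    t * dotp (rot90 d) x + (1 - t) * dotp (rot90 d) y.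
  by rewrite {1}vE affine_dotp.
have dle w : conv_hull [set` s] w -> dotp d w <= dotp d v.
  by move=> /lexX[/ltW//|[->]].
have dx : dotp d x = dotp d v by move: (dle _ Xx) (dle _ Xy); nra.
have dy : dotp d y = dotp d v by move: (dle _ Xx) (dle _ Xy); nra.
have rle w : conv_hull [set` s] w -> dotp d w = dotp d v ->
    dotp (rot90 d) w <= dotp (rot90 d) v.
  by move=> /lexX[/lt_eqF/eqP//|[]].
apply: (dotp_rot90_inj d0); first by rewrite dx.
move: (rle _ Xx dx) (rle _ Xy dy); nra.
Qed.

End Lex.

(** * Clockwise enumerations *)

Lemma nth_rot (T : Type) (x0 : T) n s j : (n < size s)%N -> (j < size s)%N ->
  nth x0 (rot n s) j = nth x0 s ((n + j) %% size s).
Proof.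
move=> ns js; rewrite /rot nth_cat size_drop nth_drop.
case: ltnP => h; first by rewrite modn_small//; lia.
rewrite nth_take; last by lia.
rewrite (_ : n + j = size s + (n + j - size s))%N; last by lia.
by rewrite modnDl modn_small; last lia; congr nth; lia.
Qed.

Section Clockwise.
(* Not the distinguished element of a pointed type. *)
Local Notation point := Defs.point.
Variable R : realType.
Local Notation pt := 'cV[R]_2.
Implicit Types (a b c p q x y z v : pt) (s t l : seq pt).

Definition turns p : rel pt := fun x y => orient p x y < 0.

(** The turning condition of [clockwise], organised for induction on lists. *)
Fixpoint cw s : bool :=
  if s is x :: s' then pairwise (turns x) s' && cw s' else true.

Lemma clockwiseP s : clockwise s <-> uniq s /\ cw s.
Proof.
split=> -[us h]; split=> //; last first.
  elim: s us h => [_ _ i j k _|x s IHs] //= /andP[_ us].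
  move=> /andP[/(pairwiseP 0) xs cws].
  move=> [|i] [|j] [|k] //= ijk ks; try by lia.
    by apply: xs; rewrite ?inE//; rewrite -ltnS//; exact: ltn_trans ks.
  exact: (IHs us cws).
elim: s us h => [//|x s IHs] /= /andP[_ us] cws; apply/andP; split.
  apply/(pairwiseP 0) => j k; rewrite !inE => js ks jk.
  by apply: (cws 0%N j.+1 k.+1); rewrite /= ?ltnS.
by apply: IHs => // i j k ijk ks; apply: (cws i.+1 j.+1 k.+1); rewrite /= ?ltnS.
Qed.

Lemma cw_rcons l x : cw (rcons l x) = cw (x :: l).
Proof.
elim: l => //= y l ->; rewrite pairwise_rcons /=.
rewrite (@eq_all _ _ (turns x y)); last by move=> z; rewrite /turns -orientC.
by case: (all _ _); case: (pairwise (turns y) l); case: (pairwise (turns x) l).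
Qed.

Lemma cw_rot n s : cw (rot n s) = cw s.
Proof.
suff cw_rot1 u : cw (rot 1 u) = cw u.
  elim: n => [|n IHn]; first by rewrite rot0.
  have [ns|ns] := ltnP n (size s); first by rewrite rotS // cw_rot1.
  by rewrite rot_oversize // ltnW.
by case: u => //= x u; rewrite rot1_cons cw_rcons.
Qed.

(** Seen from a, the other points are sorted by angle, and sorting has a unique
    result. *)
Lemma cw_unique a l1 l2 : cw (rcons l1 a) -> cw (rcons l2 a) ->
  perm_eq (rcons l1 a) (rcons l2 a) -> l1 = l2.
Proof.
rewrite !cw_rcons perm_rcons perm_sym perm_rcons perm_cons perm_sym /=.
move=> /andP[c1 _] /andP[c2 _].
apply: (pairwise_eq _ c1 c2) => x y /andP[].
by rewrite /turns orient_flip oppr_lt0 => /lt_trans h /h; rewrite ltxx.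
Qed.

Lemma cw_ear a b c l : cw (b :: c :: rcons l a) ->
  orient a b c < 0 /\
  (forall z, z \in c :: rcons l a ->
    [/\ orient a b z <= 0, orient b c z <= 0 & orient a c z <= 0]).
Proof.
rewrite -!rcons_cons cw_rcons /= => /and3P[].
move=> /andP[/andP[abc /allP ab] /andP[/allP ac _]] /andP[/allP bc _] _.
split=> // z; rewrite inE mem_rcons inE => /or3P[/eqP->|/eqP->|zl].
- by rewrite !orientr; split; rewrite // ltW.
- by rewrite !orientx -(orientC a b c); split; rewrite // ltW.
- by split; apply: ltW; [exact: ab|exact: bc|exact: ac].
Qed.

(** A repetition among x, y and the rest would make some triple starting with
    x, y degenerate. *)
Lemma cw_uniq x y z l : cw (x :: y :: z :: l) -> uniq (z :: l) ->
  uniq (x :: y :: z :: l).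
Proof.
move=> /andP[]; rewrite pairwise_cons => /andP[/allP xy _] _ uzl.
rewrite 2!cons_uniq uzl andbT.
have neq w : w \in z :: l -> w != x /\ w != y.
  move=> /xy; rewrite /turns => h; split; apply: contraTneq h => ->.
    by rewrite orientx ltxx.
  by rewrite orientr ltxx.
rewrite inE; apply/andP; split; last first.
  by apply/negP => /neq[_]; rewrite eqxx.
apply/negP => /orP[/eqP xyE|/neq[]]; last by rewrite eqxx.
by have /xy := mem_head z l; rewrite /turns xyE orientl ltxx.
Qed.

Lemma orient_segmentl a b y z r :
  orient (r *: b + (1 - r) *: a) y z =
  r * orient b y z + (1 - r) * orient a y z.
Proof. by rewrite /orient !mxE; ring. Qed.

(** The orientation of a triple starting at a cut point is an average of the
    orientations of the triples starting at the two ends of the cut side, of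
    which the one starting at b is always strictly clockwise. *)
Lemma cw_cut a b c l (r : R) : 0 < r < 1 -> uniq (b :: c :: rcons l a) ->
  cw (b :: c :: rcons l a) ->
  let s := r *: b + (1 - r) *: a :: r *: b + (1 - r) *: c :: c :: rcons l a in
  uniq s /\ cw s.
Proof.
set b' := _ + _ *: a; set c' := _ + _ *: c => r01 us cwt s.
have [abc side] := cw_ear cwt.
suff cws : cw s.
  by split=> //; apply: cw_uniq => //; move: us => /= /andP[].
have /and3P[pb pc cwl] : cw (b :: c :: rcons l a) by [].
have acb : 0 < orient a c b by rewrite orient_flip oppr_gt0.
rewrite /s; apply/and3P; split; last by rewrite /= pc.
- rewrite pairwise_cons; apply/andP; split.
    apply/allP => z /side[_ _ acz]; rewrite /turns.
    rewrite (_ : orient b' c' z = (1 - r) * (orient a c z - r * orient a c b)).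
      by have := mulr_gt0 (_ : 0 < r) acb; nra.
    by rewrite /orient /b' /c' !mxE; ring.
  rewrite -rcons_cons in pb *; rewrite !pairwise_rcons in pb *.
  case/andP: pb => /allP ba pb; apply/andP; split.
    apply/allP => y /ba; rewrite /turns orient_segmentl orientx; nra.
  have pa : pairwise (turns a) (c :: l).
    move: cwt; rewrite -!rcons_cons cw_rcons => /andP[].
    by rewrite pairwise_cons => /andP[].
  apply: (@sub_pairwise _ [rel x y | turns a x y && turns b x y]).
    by move=> x y /= /andP[]; rewrite /turns orient_segmentl; nra.
  by rewrite pairwise_relI pa pb.
- move: pb; rewrite !pairwise_cons => /andP[/allP bc pb]; apply/andP; split.
    by apply/allP => z /bc; rewrite /turns orient_segmentl orientl; nra.
  apply: (@sub_pairwise _ [rel x y | turns b x y && turns c x y]).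
    by move=> x y /= /andP[]; rewrite /turns orient_segmentl; nra.
  by rewrite pairwise_relI pb pc.
Qed.

(** The enumeration read from p^(i+1) on, so that the ear of the next query sits
    at the head b, c and at the last position a of the list. *)
Definition after i s := rot (i %% size s) s.

Lemma size_after i s : size (after i s) = size s.
Proof. exact: size_rot. Qed.

Lemma mem_after i s : after i s =i s.
Proof. exact: mem_rot. Qed.

Lemma point_after i s j : (j < size s)%N ->
  point s (i + j).+1 = nth 0 (after i s) j.
Proof.
move=> js; have s0 : (0 < size s)%N by exact: leq_ltn_trans js.
by rewrite nth_rot ?ltn_pmod// modnDml.
Qed.

Lemma point_last i s : (0 < i)%N -> (0 < size s)%N ->
  point s i = last 0 (after i s).
Proof.
move=> i0 s0; rewrite -nth_last size_after -point_after; last by lia.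
rewrite /point /=; congr nth.
by rewrite (_ : i + (size s).-1 = i.-1 + size s)%N ?modnDr//; lia.
Qed.

Lemma point_ear i s a b c l : (0 < i)%N -> after i s = b :: c :: rcons l a ->
  [/\ point s i = a, point s i.+1 = b & point s i.+2 = c].
Proof.
move=> i0 E; have sz : size s = (size l).+3.
  by rewrite -(size_after i) E /= size_rcons.
split.
- by rewrite point_last ?sz// E /= last_rcons.
- by have := @point_after i s 0; rewrite addn0 sz E; apply.
- by have := @point_after i s 1; rewrite addn1 sz E; apply.
Qed.

Lemma afterS i s : after i.+1 s = rot 1 (after i s).
Proof.
have [s0|s0] := posnP (size s).
  by rewrite (size0nil s0).
apply: (@eq_from_nth _ 0); first by rewrite !size_rot.
move=> j; rewrite size_rot => js; rewrite -point_after//.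
have [s1|s1] := eqVneq (size s) 1%N.
  case: s s0 s1 js => [|x [|//]] // _ _; case: j => // _.
  by rewrite /point /after !modn1 rot0.
rewrite nth_rot ?size_after//; last by lia.
rewrite -point_after ?ltn_pmod// /point /=; congr nth.
by rewrite modnDmr addSnnS.
Qed.

Lemma clockwise_after i s : clockwise s <-> uniq (after i s) /\ cw (after i s).
Proof. by rewrite clockwiseP /after rot_uniq cw_rot. Qed.

(** The algorithm may return any clockwise enumeration of the new vertex set
    that puts a at index i: this determines the list read from index i + 1. *)
Lemma after_unique i s l a : (0 < i)%N -> clockwise s ->
  [fset x in s]%fset = [fset x in rcons l a]%fset -> point s i = a ->
  uniq (rcons l a) -> cw (rcons l a) -> after i s = rcons l a.
Proof.
move=> i0 /(clockwise_after i)[us cws] /fsetP sE ia ul cwl.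
have mE : after i s =i rcons l a.
  by move=> x; have := sE x; rewrite !inE /= mem_after.
have pE := uniq_perm us ul mE.
have s0 : (0 < size s)%N.
  by rewrite -(size_after i) (perm_size pE) size_rcons.
move: ia; rewrite point_last//.
case/lastP: (after i s) pE us cws mE => [|l' a'].
  by move=> /perm_size; rewrite size_rcons.
rewrite last_rcons => pE _ cws _ aE; rewrite aE in pE cws *.
by rewrite (cw_unique cws cwl pE).
Qed.

Lemma after_exists i l a : (0 < i)%N -> uniq (rcons l a) -> cw (rcons l a) ->
  exists s, [/\ [fset x in s]%fset = [fset x in rcons l a]%fset,
    clockwise s & point s i = a].
Proof.
move=> i0 ul cwl; set t := rcons l a in ul cwl *.
pose s := rotr (i %% size t) t.
have sE : after i s = t by rewrite /after size_rotr rotrK.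
exists s; split.
- by apply/fsetP => x; rewrite !in_fset; exact: mem_rotr.
- by apply/(clockwise_after i); rewrite sE.
- by rewrite point_last ?size_rotr ?sE ?size_rcons// last_rcons.
Qed.

End Clockwise.

(** * The loop invariant and the number of unconfirmed vertices *)

Section Invariant.
Variable R : realType.
Local Notation pt := 'cV[R]_2.
Implicit Types (a b c d p q x y z v : pt) (s t l u w : seq pt) (X A : set pt)
  (S : {fset pt}).

Lemma seq_set_cons x s : [set` x :: s] = x |` [set` s].
Proof.
apply/seteqP; split => y /=; first by rewrite inE => /predU1P.
by case=> [->|ys]; rewrite inE ?eqxx ?ys ?orbT.
Qed.

Lemma segment_end d a b v : segment a b v -> dotp d a < dotp d b ->
  dotp d v <= dotp d a -> v = a.
Proof.
move=> [t t01 ->] dab; rewrite affine_dotp => h.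
have -> : t = 1 by nra.
by rewrite subrr scale0r addr0 scale1r.
Qed.

Lemma segment_cut d a b v (r : R) : 0 < r -> segment a b v ->
  dotp d a < dotp d b -> dotp d v <= r * dotp d b + (1 - r) * dotp d a ->
  segment a (r *: b + (1 - r) *: a) v.
Proof.
move=> r0 /segmentC[t t01 ->] dab; rewrite affine_dotp => h.
have tr : t <= r by nra.
apply: segmentC; exists (t / r).
  apply/andP; split; first by rewrite divr_ge0//; lra.
  by rewrite ler_pdivrMr// mul1r.
by apply: pt_eq; rewrite !mxE; field; lra.
Qed.

(** An edge pq of a polygon containing X touches X if X meets it; the witness
    can then be chosen among the vertices of X. *)
Definition touches X : rel pt :=
  fun p q => `[< exists2 v, vertices X v & segment p q v >].

Lemma touchesP X p q :
  reflect (exists2 v, vertices X v & segment p q v) (touches X p q).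
Proof. exact: asboolP. Qed.

(** Take one vertex of X on the edge between the 1st and the 2nd point of u,
    one between the 3rd and the 4th, and so on.  By convexity the line of an
    edge strictly separates it from all later points of the polygon, which
    makes the chosen vertices distinct from each other and from the points of
    w. *)
Lemma edge_vertices X u w : cw (u ++ w) -> sorted (touches X) u ->
  exists l, [/\ size l = (size u)./2, uniq l,
    (forall x, x \in l -> vertices X x /\ conv_hull [set` u] x) &
    (forall x, x \in l -> x \notin w)].
Proof.
have [n] := ubnP (size u); elim: n u => // n IHn [|p [|q u]] sn cwt ut.
- by exists [::].
- by exists [::].
have [] := IHn u.
- by rewrite -ltnS; apply: ltn_trans sn; rewrite /= ltnS.
- by move: cwt => /= /and3P[].
- by move: ut => /= /andP[_]; exact: path_sorted.
move=> l [ls ul lX lw].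
have /andP[/touchesP[v Xv pqv] _] : touches X p q && path (touches X) q u by [].
have /allP pq_lt : all (turns p q) (u ++ w) by move: cwt => /= /andP[/andP[]].
have pqv0 : orient p q v = 0.
  by case: pqv => t t01 ->; rewrite affine_orient orientx orientr !mulr0 addr0.
have hull_lt : forall x, conv_hull [set` u] x -> orient p q x < 0.
  apply: affine_hull_lt; first exact: affine_orient.
  by move=> x xu; apply: pq_lt; rewrite mem_cat xu.
exists (v :: l); split.
- by rewrite /= ls.
- rewrite /= ul andbT; apply/negP => /lX[_ /hull_lt].
  by rewrite pqv0 ltxx.
- move=> x; rewrite inE => /predU1P[->|/lX[Xx ux]]; split=> //.
    apply: (conv_hull_segment _ _ pqv); apply: conv_hull_sub => /=.
      by rewrite mem_head.
    by rewrite !inE eqxx orbT.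
  by apply: conv_hull_mono ux => y /= yu; rewrite !inE yu !orbT.
- move=> x; rewrite inE => /predU1P[->|/lw//].
  apply/negP => vw; have /pq_lt : v \in u ++ w by rewrite mem_cat vw orbT.
  by rewrite /turns pqv0 ltxx.
Qed.

Section Count.
Variables (X : set pt) (nv : nat).
Hypothesis X_nv : vertices X #= `I_nv.

Lemma card_known l : uniq l -> (forall x, x \in l -> vertices X x) ->
  (size l <= nv)%N.
Proof.
move=> ul lX; rewrite -(card_fset_set X_nv).
have finX : finite_set (vertices X) by exists nv.
rewrite -(undup_id ul) -card_fseq; apply: fsubset_leq_card.
apply/fsubsetP => x; rewrite in_fset => /lX Xx.
by rewrite in_fset_set// in_setE.
Qed.

Lemma known_all l : uniq l -> (forall x, x \in l -> vertices X x) ->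
  (nv <= size l)%N -> forall v, vertices X v -> v \in l.
Proof.
move=> ul lX sl v Xv; apply: contraT => vl.
have := @card_known (v :: l); rewrite /= vl ul => /(_ isT).
rewrite leqNgt ltnS sl; apply.
by move=> x; rewrite inE => /predU1P[->//|/lX].
Qed.

End Count.

(** The list t is the enumeration of P_v read from p^(i+1) on; its first r
    points are the unconfirmed ones.  With at most two points left, all of
    them are confirmed, so a query always finds a genuine ear. *)
Record loop_invariant X t (r : nat) S : Prop := LoopInvariant {
  inv_uniq : uniq t;
  inv_cw : cw t;
  inv_hull : X `<=` conv_hull [set` t];
  inv_touches : cycle (touches X) t;
  inv_known : S = [fset x in drop r t]%fset;
  inv_vertices : forall x, x \in drop r t -> vertices X x;
  inv_size : (r <= size t)%N;
  inv_ear : r = 0%N \/ (3 <= size t)%N }.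

(** The points of S and the vertices of X found by [edge_vertices] among the
    unconfirmed points are distinct vertices of X. *)
Lemma inv_count X t r S nv : vertices X #= `I_nv -> loop_invariant X t r S ->
  (size t - r + r./2 <= nv)%N.
Proof.
move=> X_nv [ut cwt _ touch _ Xt rt _].
have [||l [ls ul lX lt]] := @edge_vertices X (take r t) (drop r t).
- by rewrite cat_take_drop.
- have : sorted (touches X) t.
    by case: (t) touch => //= x t'; rewrite rcons_path => /andP[].
  by rewrite -{1}(cat_take_drop r t) => /cat_sorted2[].
have := @card_known X nv X_nv (l ++ drop r t).
rewrite size_cat size_drop ls size_takel// addnC; apply.
  rewrite cat_uniq ul drop_uniq// andbT; apply/hasPn => x xt.
  by apply/negP => /lt; rewrite xt.
by move=> x; rewrite mem_cat => /orP[/lX[]|/Xt].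
Qed.

Lemma inv_card X t r S : loop_invariant X t r S -> #|` S| = (size t - r)%N.
Proof.
by case=> ut _ _ _ -> _ _ _; rewrite card_fseq undup_id ?drop_uniq// size_drop.
Qed.

Lemma inv_rest X t r S : loop_invariant X t r S -> (0 < r)%N ->
  exists a b c l, t = b :: c :: rcons l a.
Proof.
case=> _ _ _ _ _ _ _ [->//|]; case: t => [|b [|c t]]//= + _.
by case/lastP: t => // l a _; exists a, b, c, l.
Qed.

Lemma inv_final X t S : polytope X -> loop_invariant X t 0 S ->
  [set` S] = vertices X.
Proof.
move=> [V XV] [_ _ Xt _ -> tX _ _]; rewrite drop0 in tX *.
apply/seteqP; split => x /=; first by rewrite in_fset; exact: tX.
move=> Xx; rewrite in_fset.
apply: (@vertex_generator _ [set` t] X) => //.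
- by rewrite XV; exact: conv_hull_convex.
- by move=> y /tX[].
- by apply: Xt; case: Xx.
Qed.

End Invariant.

(** * Effect of one query on the invariant *)

(** The number of unconfirmed vertices after a deletion: the tip is gone and c
    becomes confirmed; if nothing was confirmed before, so does a.  For r = 1
    the point c is already confirmed, and truncated subtraction gives 0. *)
Definition delete_rank (N r : nat) : nat :=
  (if r == N then r - 3 else r - 2)%N.

Section Steps.
Variable R : realType.
Local Notation pt := 'cV[R]_2.
Implicit Types (a b c d p q x y z v : pt) (s t l u w : seq pt) (S : {fset pt}).
Variables (X : set pt) (D : pt -> R).
Hypotheses (X_neq0 : X !=set0) (X_polytope : polytope X)
  (D_oracle : is_oracle X D).

Lemma oracle_ge d x : X x -> dotp d x <= D d.
Proof.
by move=> Xx; case: (D_oracle d) => _; apply; exists x; rewrite // dotpC.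
Qed.

Lemma oracle_vertex d : d != 0 -> exists2 v, vertices X v & dotp d v = D d.
Proof.
move=> d0; have [v Xv vmax] := vertex_max X_polytope X_neq0 d0.
exists v => //; apply/eqP; rewrite eq_le oracle_ge; last by case: Xv.
by case: (D_oracle d) => -[x Xx <-] _; rewrite dotpC vmax.
Qed.

Section Query.
Variables (t l : seq pt) (a b c d : pt) (r : nat) (S : {fset pt}).
Hypotheses (tE : t = b :: c :: rcons l a) (inv : loop_invariant X t r S).
Hypothesis r_gt0 : (0 < r)%N.
Hypotheses (dac : dotp d a = dotp d c) (dab : dotp d a < dotp d b).

Local Notation A := [set` c :: rcons l a].

Let cwt : cw (b :: c :: rcons l a). Proof. by rewrite -tE; case: inv. Qed.
Let earA : ear a b c d A.
Proof.
have [abc side] := cw_ear cwt; split=> //=; last exact: mem_head.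
by rewrite inE mem_rcons mem_head orbT.
Qed.
Let sub z : X z -> conv_hull (b |` A) z.
Proof. by case: inv => _ _ h _ _ _ _ _ /h; rewrite tE seq_set_cons. Qed.

Let d0 : d != 0.
Proof. by apply: contraTneq dab => ->; rewrite !dotpE !mxE !mul0r ltxx. Qed.

Let touches_path : [/\ touches X b c, path (touches X) c (rcons l a) &
  touches X a b].
Proof.
case: inv => _ _ _ + _ _ _ _; rewrite tE /= rcons_path last_rcons.
by case/and3P.
Qed.

(** The lower bound holds because the edge ab touches X and lies above the
    diagonal ac. *)
Lemma oracle_range : dotp d a <= D d <= dotp d b.
Proof.
apply/andP; split; last first.
  have [v [Xv _] <-] := oracle_vertex d0.
  exact: (ear_tip_le earA (sub Xv)).
have [_ _ /touchesP[v [Xv _] abv]] := touches_path.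
apply: le_trans (oracle_ge d Xv).
by apply: (affine_segment_ge (affine_dotp d) abv); rewrite // ltW.
Qed.

(** Some vertex of X attains the height of b, and b is the only point of P at
    that height. *)
Lemma invariant_vertex : D d = dotp d b ->
  loop_invariant X (rot 1 t) r.-1 (S `|` [fset b])%fset.
Proof.
move=> Db; have Xb : vertices X b.
  have [v Xv dv] := oracle_vertex d0.
  suff <- : v = b by [].
  apply: (ear_tip earA) => //; first by apply: sub; case: Xv.
  by rewrite dv.
have dropE : drop r.-1 (rot 1 t) = rcons (drop r t) b.
  move: (inv_size inv); rewrite tE rot1_cons; case: (r) r_gt0 => // r' _ rs.
  by rewrite drop_rcons.
case: inv => ut ct ht tt SE vt rt et; split.
- by rewrite rot_uniq.
- by rewrite cw_rot.
- by move=> x /ht; apply: conv_hull_mono => y /=; rewrite mem_rot.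
- by rewrite rot_cycle.
- by rewrite dropE SE; apply/fsetP => x; rewrite !inE /= mem_rcons inE orbC.
- by move=> x; rewrite dropE mem_rcons inE => /predU1P[->|/vt].
- by rewrite size_rot; apply: leq_trans rt; exact: leq_pred.
- right; rewrite size_rot tE /= size_rcons //.
Qed.

(** X lies below the diagonal and touches the edges ab and bc, which it can do
    only at a and c; hence the new edge ac touches X as well. *)
Lemma invariant_delete : D d = dotp d a ->
  loop_invariant X (rot 1 (c :: rcons l a))
    (delete_rank (size t) r) (S `|` [fset a; c])%fset.
Proof.
move=> Da.
have [/touchesP[vc Xvc bcv] pc /touchesP[va Xva abv]] := touches_path.
have Xa : vertices X a.
  by rewrite -(segment_end abv dab) // -Da; apply: oracle_ge; case: Xva.
have Xc : vertices X c.
  rewrite -(@segment_end _ d c b vc (segmentC bcv)) -?dac // -Da.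
  by apply: oracle_ge; case: Xvc.
set r' := delete_rank _ _.
have sz : size t = (size l).+3 by rewrite tE /= size_rcons.
have rt := inv_size inv.
have memE x : (x \in drop r' (rot 1 (c :: rcons l a))) =
    [|| x \in drop r t, x == a | x == c].
  rewrite rot1_cons /r' /delete_rank; case: eqVneq => [rE|rN].
    rewrite rE sz [drop _ t]drop_oversize ?sz //.
    rewrite -cats1 -cats1 -catA drop_cat !subSS subn0 ltnn subnn drop0.
    by rewrite !inE.
  (* For r = 1, c and a are the ends of the list of confirmed vertices. *)
  have [r1|r1] := eqVneq r 1%N.
    rewrite r1 tE /= drop0 !(mem_rcons, inE).
    by case: (x == a); case: (x == c); rewrite ?orbT ?orbF.
  have rE : r = (r - 2).+2 by move: r_gt0 r1; lia.
  have rl : (r - 2 <= size l)%N by move: rt rN; rewrite sz; lia.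
  rewrite [in RHS]rE tE /= !drop_rcons ?size_rcons ?(leqW rl)//.
  rewrite !(mem_rcons, inE).
  by case: (x == a); case: (x == c); rewrite ?orbT ?orbF.
case: inv => ut ct ht tt SE vt _ _; split.
- by rewrite rot_uniq; move: ut; rewrite tE => /andP[].
- by rewrite cw_rot; move: cwt => /andP[].
- move=> x Xx.
  (* At r = 0 the two cut points are a and c. *)
  have r01 : 0 <= (0 : R) < 1 by rewrite lexx ltr01.
  have := ear_cut earA r01 (sub Xx).
  rewrite mul0r add0r subr0 mul1r !scale0r !add0r !scale1r -Da.
  move/(_ (oracle_ge d Xx)); apply: conv_hull_mono => y /=.
  rewrite mem_rot => -[[->|->]|//]; first exact: ear_left earA.
  exact: ear_right earA.
- rewrite rot_cycle /= rcons_path pc last_rcons /=.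
  by apply/touchesP; exists a => //; exact: segmentl.
- by rewrite SE; apply/fsetP => x; rewrite in_fsetU in_fset2 !in_fset memE.
- by move=> x; rewrite memE => /or3P[/vt|/eqP->|/eqP->].
- rewrite size_rot /= size_rcons /r' /delete_rank.
  by case: ifP => _; move: rt; rewrite sz; lia.
- rewrite size_rot /= size_rcons /r' /delete_rank.
  by case: eqVneq => rN; move: rt rN; rewrite sz; lia.
Qed.

(** The new edge touches X at any vertex of X maximising d.  The vertex of X on
    an old side of the ear lies below the cutting line, that is, on the part
    of the side that is kept. *)
Lemma invariant_cut (k : R) :
  0 < k < 1 -> D d = k * dotp d b + (1 - k) * dotp d a ->
  loop_invariant X
    (k *: b + (1 - k) *: a :: k *: b + (1 - k) *: c :: c :: rcons l a) r.+1 S.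
Proof.
move=> k01 Dk; set b' := _ + _ *: a; set c' := _ + _ *: c.
have [/touchesP[vc Xvc bcv] pc /touchesP[va Xva abv]] := touches_path.
have k01' : 0 <= k < 1 by lra.
have k0 : 0 < k by lra.
have ut : uniq (b :: c :: rcons l a) by rewrite -tE; case: inv.
have [us cs] := cw_cut k01 ut cwt.
have dropE : drop r.+1 [:: b', c', c & rcons l a] = drop r t.
  by rewrite tE; case: (r) r_gt0.
case: inv => _ ct ht tt SE vt rt et; split.
- exact: us.
- exact: cs.
- move=> x Xx; have := oracle_ge d Xx.
  rewrite Dk => /(ear_cut earA k01' (sub Xx)).
  apply: conv_hull_mono => y /= [[]->|yA]; rewrite !in_cons ?eqxx ?orbT//.
  by move: yA; rewrite in_cons => ->; rewrite !orbT.
- rewrite /= rcons_path pc last_rcons /=; apply/and3P; split; apply/touchesP.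
  + have [v Xv dv] := oracle_vertex d0; exists v => //.
    apply: (ear_cut_line earA k01'); last by rewrite dv.
    by apply: sub; case: Xv.
  + exists vc => //; apply: segmentC.
    apply: (@segment_cut _ d c b vc k k0 (segmentC bcv)); first by rewrite -dac.
    by rewrite -dac -Dk; apply: oracle_ge; case: Xvc.
  + exists va => //; apply: (segment_cut k0 abv dab).
    by rewrite -Dk; apply: oracle_ge; case: Xva.
- by rewrite dropE.
- by rewrite dropE.
- by move: rt; rewrite tE.
- by right.
Qed.

Lemma cut_edge_set (k : R) : 0 < k < 1 ->
  D d = k * dotp d b + (1 - k) * dotp d a ->
  edge_set (conv_hull [set` t]) `&` supp_line D d =
  [set k *: b + (1 - k) *: a; k *: b + (1 - k) *: c].
Proof.
move=> k01 Dk; rewrite tE seq_set_cons /supp_line Dk.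
by apply: (ear_edge_set earA); lra.
Qed.

End Query.
End Steps.

(** * Counting oracle calls *)

Section Budget.
Local Open Scope nat_scope.

Lemma vertex_measure nv n N r : 0 < r ->
  3 * nv + 2 * r + 2 < n.+1 + 3 * N -> 3 * nv + 2 * r.-1 + 2 < n + 3 * N.
Proof. lia. Qed.

Lemma cut_measure nv n N r :
  3 * nv + 2 * r + 2 < n.+1 + 3 * N -> 3 * nv + 2 * r.+1 + 2 < n + 3 * N.+1.
Proof. lia. Qed.

Lemma delete_measure nv n N r :
  0 < delete_rank N r -> 3 * nv + 2 * r + 2 < n.+1 + 3 * N ->
  3 * nv + 2 * delete_rank N r + 2 < n + 3 * N.-1.
Proof. by rewrite /delete_rank; case: eqP => [->|_] r0 ms; lia. Qed.

Variables (nv K slack : nat).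
Hypothesis slack12 : 0 < slack <= 2.

(** With r unconfirmed vertices among N, and k calls made, at most K calls will
    be made in all.  The boolean r == N is the call saved by the first query
    that is not a cut; [slack] is 1 if the execution stops as soon as all nv
    vertices are confirmed, and 2 if a last deletion may follow. *)
Definition budget (N r k : nat) : bool :=
  if r == 0 then k <= K else k + 3 * nv + 2 * r + slack <= K + 3 * N + (r == N).

Lemma budget_vertex N r k : 0 < r <= N -> 2 < N -> N - r.-1 + (r.-1)./2 <= nv ->
  budget N r k -> budget N r.-1 k.+1.
Proof. by move: slack12; rewrite /budget; do !case: ifP; lia. Qed.

(** For r = 1 the deletion leaves N - 1 <= nv confirmed vertices.  If slack = 1,
    the number N - 1 of vertices confirmed before the call is less than nv, and
    the budget has room to spare; if slack = 2, its second unit pays the call. *)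
Lemma budget_delete N r k : 0 < r <= N -> 2 < N ->
  N.-1 - delete_rank N r + (delete_rank N r)./2 <= nv ->
  (slack = 1 -> N - r < nv) ->
  budget N r k -> budget N.-1 (delete_rank N r) k.+1.
Proof.
rewrite /budget /delete_rank => rN N2 cnt s1.
have {}s1 : slack = 2 \/ slack = 1 /\ N - r < nv by lia.
rewrite (_ : (r == 0) = false); last by lia.
move: cnt; case: (eqVneq r N) => [->|neq] cnt bud; case: ifP => r'0.
- lia.
- lia.
- lia.
- lia.
Qed.

Lemma budget_cut N r k : 0 < r <= N ->
  budget N r k -> budget N.+1 r.+1 k.+1.
Proof.
rewrite /budget /= eqSS => /andP[r0 _].
by rewrite (_ : (r == 0) = false); lia.
Qed.

Lemma budget_exit N r k : 2 < N -> 0 < r <= N -> N - r + r./2 <= nv ->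
  nv <= N - r -> budget N r k -> k <= K.
Proof.
move=> N2 rN cnt nvN; rewrite /budget (_ : (r == 0) = false); last by lia.
by case: (eqVneq r N) => [->|neq]; move: slack12; lia.
Qed.

End Budget.

(** * Execution of the loop *)

Section Loop.
Variable R : realType.
Local Notation pt := 'cV[R]_2.
Local Notation point := Defs.point.
Implicit Types (a b c d p q x y z v : pt) (s t l : seq pt) (S : {fset pt}).

Lemma halts_with_weaken (D : pt -> R) nf (Q Q' : {fset pt} -> nat -> Prop) st :
  (forall S k, Q S k -> Q' S k) ->
  halts_with D nf Q st -> halts_with D nf Q' st.
Proof.
move=> QQ'; elim=> [S k /QQ'|st' ex _ IH]; first exact: halts_now.
exact: halts_later.
Qed.

Lemma loop_step (D : pt -> R) nf s i S k st : step D nf (Loop s i S k) st ->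
  ~~ loop_guard nf s S /\ st = Halt S k \/
  exists2 d, [/\ loop_guard nf s S, dotp d (point s i) = dotp d (point s i.+2) &
    dotp d (point s i) < dotp d (point s i.+1)] & st = Query s i S d k.+1.
Proof. by move=> h; inversion h; subst; [left|right; exists d]. Qed.

Lemma halts_exit (D : pt -> R) nf (Q : {fset pt} -> nat -> Prop) s i S k :
  ~~ loop_guard nf s S -> Q S k -> halts_with D nf Q (Loop s i S k).
Proof.
move=> ng QSk; apply: halts_later; first by exists (Halt S k); exact: step_exit.
move=> st /loop_step[[_ ->]|[d [guard _ _] _]]; first exact: halts_now.
by rewrite guard in ng.
Qed.

Lemma query_step (D : pt -> R) nf s i S d k st :
  step D nf (Query s i S d k) st ->
  [\/ D d = dotp d (point s i.+1) /\
      st = Loop s i.+1 (S `|` [fset point s i.+1])%fset k,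
      exists s', [/\ D d = dotp d (point s i),
        [fset x in s']%fset = ([fset x in s] `\ point s i.+1)%fset,
        clockwise s', point s' i = point s i &
        st = Loop s' i.+1 (S `|` [fset point s i; point s i.+2])%fset k] |
      exists b' c' s', [/\ dotp d (point s i) < D d < dotp d (point s i.+1) /\
        [set b'; c'] = edge_set (conv_hull [set` s]) `&` supp_line D d,
        [fset x in s']%fset =
          (([fset x in s] `\ point s i.+1) `|` [fset b'; c'])%fset,
        clockwise s', point s' i = point s i & st = Loop s' i S k]].
Proof.
move=> h; inversion h; subst; [by apply: Or31|apply: Or32|apply: Or33].
  by exists s'.
by exists b', c', s'.
Qed.

(** The diagonal c - a turned by a quarter. *)
Lemma query_direction a b c : orient a b c < 0 ->
  exists2 d, dotp d a = dotp d c & dotp d a < dotp d b.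
Proof.
move=> abc; exists (rot90 (c - a)); first by rewrite !dotp_rot90 !mxE; ring.
rewrite -subr_gt0 (_ : _ - _ = - orient a b c) ?oppr_gt0//.
by rewrite !dotp_rot90 /orient !mxE; ring.
Qed.

Lemma fset_after i s b t : uniq (after i s) -> after i s = b :: t ->
  ([fset x in s] `\ b = [fset x in t])%fset.
Proof.
move=> us E; apply/fsetP => x; rewrite in_fsetD1 !in_fset -(mem_after i) E inE.
move: us; rewrite E /= => /andP[bt _].
by case: eqVneq => [->|]//=; rewrite (negbTE bt).
Qed.

Variables (X : set pt) (D : pt -> R) (nv : nat) (nf : option nat).
Hypotheses (X_neq0 : X !=set0) (X_polytope : polytope X)
  (X_nv : vertices X #= `I_nv) (D_oracle : is_oracle X D)
  (nf_ge : bound_ge nf nv).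

Definition slack : nat := if nf == Some nv then 1%N else 2%N.

Lemma slack12 : (0 < slack <= 2)%N.
Proof. by rewrite /slack; case: ifP. Qed.

Definition outcome (K : nat) S k := [set` S] = vertices X /\ (k <= K)%N.

(** The loop ends either because everything is confirmed, or because S has at
    least nf >= nv elements, all of them vertices of X. *)
Lemma exit_outcome K s i S k r :
  loop_invariant X (after i s) r S -> budget nv K slack (size s) r k ->
  ~~ loop_guard nf s S -> outcome K S k.
Proof.
have [->|r0] := posnP r => inv; first by split; [exact: inv_final inv|].
move=> bud ng; have cnt := inv_count X_nv inv; have cS := inv_card inv.
have rs := inv_size inv; have N3 : (2 < size s)%N.
  by case: (inv_ear inv) r0 => [->//|]; rewrite size_after.
rewrite size_after in cnt cS rs.
have SE := inv_known inv; have us := inv_uniq inv; have Sv := inv_vertices inv.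
have nvS : (nv <= #|` S|)%N.
  move: ng; rewrite negb_and negbK => /orP[/eqP sS|].
    exfalso; move: cS; rewrite -sS card_fseq undup_id; last first.
      by move: us; rewrite rot_uniq.
    by move: rs r0 N3; case: (size s) => // N; lia.
  case: nf nf_ge => //= m nvm; rewrite -leqNgt; exact: leq_trans.
split; last first.
  by apply: (budget_exit slack12 N3 _ cnt _ bud); [rewrite r0|rewrite -cS].
rewrite SE; apply/seteqP; split=> x /=; first by rewrite in_fset; exact: Sv.
rewrite in_fset; apply: (known_all X_nv) => //; first exact: drop_uniq.
by rewrite size_drop size_after -cS.
Qed.

Lemma cut_ratio (e f g : R) : e < f < g ->
  exists2 k, 0 < k < 1 & f = k * g + (1 - k) * e.
Proof.
move=> efg; exists ((f - e) / (g - e)); last by field; lra.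
by apply/andP; split; [rewrite divr_gt0//; lra|rewrite ltr_pdivrMr ?mul1r; lra].
Qed.

Lemma set2_eq (x y p q : pt) : [set x; y] = [set p; q] ->
  forall z, (z == x) || (z == y) = (z == p) || (z == q).
Proof.
move=> E z; have memE (u v : pt) : (z == u) || (z == v) = `[< [set u; v] z >].
  apply/idP/asboolP => [/orP[]/eqP ->|[]->]; rewrite ?eqxx ?orbT//.
    by left.
  by right.
by rewrite !memE E.
Qed.
Lemma guard_rank s i S r : loop_invariant X (after i s) r S ->
  loop_guard nf s S -> [/\ (0 < r)%N, (r <= size s)%N & (2 < size s)%N].
Proof.
move=> inv /andP[neq _]; have rs := inv_size inv.
have r0 : (0 < r)%N.
  rewrite lt0n; apply: contraNneq neq => r0.
  rewrite (inv_known inv) r0 drop0; apply/eqP/fsetP => x.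
  by rewrite !in_fset mem_after.
by case: (inv_ear inv) r0 rs => [->//|]; rewrite size_after.
Qed.

(** The decreasing quantity 3 nv + 2 r - 3 N never drops below - 2. *)
Lemma rank_measure s i S r : loop_invariant X (after i s) r S ->
  (r <= size s)%N -> (3 * size s <= 3 * nv + 2 * r + 2)%N.
Proof.
by move=> /(inv_count X_nv); rewrite size_after; case: (size s) => [|N]; lia.
Qed.

(** Induction on a bound n for 3 nv + 2 r + 2 - 3 N, which every query
    decreases as long as an unconfirmed vertex remains. *)
Lemma loop_halts K n s i S k r : (0 < i)%N ->
  loop_invariant X (after i s) r S -> budget nv K slack (size s) r k ->
  ((0 < r)%N -> (3 * nv + 2 * r + 2 < n + 3 * size s)%N) ->
  halts_with D nf (outcome K) (Loop s i S k).
Proof.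
elim: n s i S k r => [|n IHn] s i S k r i0 inv bud meas;
  (have [guard|ng] := boolP (loop_guard nf s S);
    last by apply: halts_exit => //; exact: exit_outcome inv bud ng);
  have [r0 rN N3] := guard_rank inv guard.
  by have := leq_trans (meas r0) (rank_measure inv rN); rewrite ltnn.
have [a [b [c [l tE]]]] := inv_rest inv r0.
have [pa pb pc] := point_ear i0 tE.
have ut : uniq (b :: c :: rcons l a) by rewrite -tE; case: inv.
have cwt : cw (b :: c :: rcons l a) by rewrite -tE; case: inv.
have [abc _] := cw_ear cwt.
have sE : [set` s] = [set` after i s].
  by apply/seteqP; split=> x /=; rewrite mem_after.
have sz : size s = (size l).+3 by rewrite -(size_after i) tE /= size_rcons.
have ucl : uniq (rcons (c :: l) a) by move: ut => /andP[].
have ccl : cw (rcons (c :: l) a) by move: cwt => /andP[].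
have fE : ([fset x in s] `\ b = [fset x in rcons (c :: l) a])%fset.
  have us : uniq (after i s) by rewrite tE.
  exact: (fset_after us tE).
apply: halts_later => [|st h].
  have [d dac dab] := query_direction abc.
  by exists (Query s i S d k.+1); apply: step_query; rewrite ?pa ?pb ?pc.
case: (loop_step h) => [[ng _]|[d]]; first by rewrite guard in ng.
rewrite pa pb pc => -[_ dac dab] -> {st h}.
have range := oracle_range X_neq0 X_polytope D_oracle tE inv dac dab.
have halts_vertex : D d = dotp d b ->
    halts_with D nf (outcome K) (Loop s i.+1 (S `|` [fset b])%fset k.+1).
  move=> Db.
  have inv' := invariant_vertex X_neq0 X_polytope D_oracle tE inv r0 dac dab Db.
  rewrite -afterS in inv'.
  have cnt := inv_count X_nv inv'; rewrite size_after in cnt.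
  apply: (IHn _ _ _ _ _ _ inv') => //.
    by apply: (budget_vertex slack12) bud => //; rewrite r0.
  by move=> _; exact: (vertex_measure r0 (meas r0)).
have halts_delete s' : D d = dotp d a ->
    [fset x in s']%fset = ([fset x in s] `\ b)%fset ->
    clockwise s' -> point s' i = a ->
    halts_with D nf (outcome K) (Loop s' i.+1 (S `|` [fset a; c])%fset k.+1).
  move=> Da s'E cs' ia; rewrite fE in s'E.
  have aE := after_unique i0 cs' s'E ia ucl ccl.
  have inv' := invariant_delete D_oracle tE inv r0 dac dab Da.
  rewrite -rcons_cons -aE -afterS size_after in inv'.
  have cnt := inv_count X_nv inv'; rewrite size_after in cnt.
  have sz' : size s' = (size s).-1.
    by rewrite -(size_after i) aE sz /= size_rcons.
  apply: (IHn _ _ _ _ _ _ inv') => //.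
    rewrite sz' in cnt *; apply: (budget_delete slack12) bud => //.
      by rewrite r0.
    rewrite /slack; case: eqP => // nfE _; move: guard => /andP[_].
    by rewrite nfE /= (inv_card inv) size_after.
  by rewrite sz' => r'0; apply: delete_measure (meas r0).
have halts_cut b' c' s' : dotp d a < D d < dotp d b ->
    [set b'; c'] = edge_set (conv_hull [set` s]) `&` supp_line D d ->
    [fset x in s']%fset =
      (([fset x in s] `\ b) `|` [fset b'; c'])%fset ->
    clockwise s' -> point s' i = a ->
    halts_with D nf (outcome K) (Loop s' i S k.+1).
  move=> /cut_ratio[m m01 Dm] bcE s'E cs' ia.
  have [us cs] := cw_cut m01 ut cwt.
  have inv' := invariant_cut X_neq0 X_polytope D_oracle tE inv r0 dac dab
    m01 Dm.
  have esE := cut_edge_set tE inv dac dab m01 Dm.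
  rewrite sE esE in bcE.
  rewrite -!rcons_cons in us cs inv'.
  have aE : after i s' =
      rcons [:: m *: b + (1 - m) *: a, m *: b + (1 - m) *: c, c & l] a.
    apply: (after_unique i0 cs' _ ia us cs).
    rewrite s'E fE; apply/fsetP => x; rewrite in_fsetU in_fset2 !in_fset.
    by rewrite (set2_eq bcE) /= !inE orbC -orbA.
  rewrite -aE in inv'.
  have sz' : size s' = (size s).+1.
    by rewrite -(size_after i) aE sz /= size_rcons.
  apply: (IHn _ _ _ _ _ _ inv') => //.
    by rewrite sz'; apply: (budget_cut slack12) bud => //; rewrite r0.
  by move=> _; rewrite sz'; exact: cut_measure (meas r0).
apply: halts_later => [|st' h'].
  case/andP: range; rewrite le_eqVlt => /predU1P[aD _|aD].
    have [s' [s'E cs' ia]] := after_exists i0 ucl ccl.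
    exists (Loop s' i.+1 (S `|` [fset point s i; point s i.+2])%fset k.+1).
    by apply: step_delete; rewrite ?pa ?pb ?fE.
  rewrite le_eqVlt => /predU1P[Db|Db].
    exists (Loop s i.+1 (S `|` [fset point s i.+1])%fset k.+1).
    by apply: step_vertex; rewrite pb.
  have aDb : dotp d a < D d < dotp d b by rewrite aD.
  have [m m01 Dm] := cut_ratio aDb.
  have [us cs] := cw_cut m01 ut cwt.
  rewrite -!rcons_cons in us cs.
  have [s' [s'E cs' ia]] := after_exists i0 us cs.
  exists (Loop s' i S k.+1).
  apply: (@step_cut _ _ _ s i S d k.+1
    (m *: b + (1 - m) *: a) (m *: b + (1 - m) *: c)); rewrite ?pa ?pb ?fE//.
  - by move: us => /= /andP[]; rewrite inE negb_or => /andP[].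
  - by rewrite -(cut_edge_set tE inv dac dab m01 Dm) sE.
  - rewrite s'E; apply/fsetP => x; rewrite in_fsetU in_fset2 !in_fset.
    by rewrite /= !inE [RHS]orbC -orbA.
case: (query_step h'); rewrite pb ?pc.
- by move=> [Db ->]; exact: halts_vertex.
- move=> [s' [Da s'E cs' ia ->]]; rewrite pa in Da ia *.
  exact: halts_delete.
- move=> [b' [c' [s' [[aDb bcE] s'E cs' ia ->]]]]; rewrite pa in aDb ia.
  exact: halts_cut bcE s'E cs' ia.
Qed.

End Loop.

(** * The initial triangle *)

Section Start.
Variable R : realType.
Local Notation pt := 'cV[R]_2.
Implicit Types (a b c d p q x y z v : pt) (s t l : seq pt) (S : {fset pt}).

Lemma dotp_e1 v : dotp (@e1 R) v = v 0 0.
Proof. by rewrite dotpE !mxE /=; ring. Qed.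

Lemma dotp_e2 v : dotp (@e2 R) v = v 1 0.
Proof. by rewrite dotpE !mxE /=; ring. Qed.

Lemma dotp_e12 v : dotp (- @e1 R - @e2 R) v = - v 0 0 - v 1 0.
Proof. by rewrite dotpE !mxE /=; ring. Qed.

Lemma e1_neq0 : @e1 R != 0.
Proof.
by apply/eqP => /matrixP/(_ 0 0); rewrite !mxE /= => /eqP; rewrite oner_eq0.
Qed.

Lemma e2_neq0 : @e2 R != 0.
Proof.
by apply/eqP => /matrixP/(_ 1 0); rewrite !mxE /= => /eqP; rewrite oner_eq0.
Qed.

Lemma e12_neq0 : - @e1 R - @e2 R != 0.
Proof.
apply/eqP => /matrixP/(_ 0 0); rewrite !mxE /= subr0 => /eqP.
by rewrite oppr_eq0 oner_eq0.
Qed.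

Lemma outerP (D : pt -> R) v : outer D init_dirs v <->
  [/\ v 0 0 <= D (@e1 R), v 1 0 <= D (@e2 R) &
      - v 0 0 - v 1 0 <= D (- @e1 R - @e2 R)].
Proof.
split=> [h|[h1 h2 h3] d /=]; last first.
  rewrite !inE => /or3P[]/eqP->; rewrite dotpC;
  by rewrite ?dotp_e1 ?dotp_e2 ?dotp_e12.
have hE d : d \in init_dirs -> dotp d v <= D d.
  by move=> dE; rewrite dotpC; exact: (h d).
have := hE (@e1 R); have := hE (@e2 R); have := hE (- @e1 R - @e2 R).
rewrite dotp_e1 dotp_e2 dotp_e12 !inE !eqxx !orbT => h3 h2 h1.
by split; [exact: h1|exact: h2|exact: h3].
Qed.

Lemma convex_tight (x y t r : R) : 0 < t < 1 -> x <= r -> y <= r ->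
  r = t * x + (1 - t) * y -> x = y.
Proof. by move=> t01 xr yr; nra. Qed.

Lemma coord_comb p q (t : R) i :
  (t *: p + (1 - t) *: q) i 0 = t * p i 0 + (1 - t) * q i 0.
Proof. by rewrite !mxE. Qed.

Variables (X : set pt) (D : pt -> R) (nv : nat) (nf : option nat).
Hypotheses (X_neq0 : X !=set0) (X_polytope : polytope X)
  (X_nv : vertices X #= `I_nv) (D_oracle : is_oracle X D)
  (nf_ge : bound_ge nf nv).

Local Notation P := (outer D init_dirs).
Local Notation width := (D (@e1 R) + D (@e2 R) + D (- @e1 R - @e2 R)).

Lemma sub_outer : X `<=` P.
Proof.
move=> x Xx; apply/outerP; split.
- by rewrite -dotp_e1; exact: oracle_ge Xx.
- by rewrite -dotp_e2; exact: oracle_ge Xx.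
- by rewrite -dotp_e12; exact: oracle_ge Xx.
Qed.

Lemma width_ge0 : 0 <= width.
Proof. by case: X_neq0 => x /sub_outer/outerP[]; lra. Qed.

(** The common point of the first two sides; the other two corners of the
    triangle are at distance [width] from it, downwards and to the left, and
    the triangle is a point when the width vanishes. *)
Definition corner0 : pt := D (@e1 R) *: @e1 R + D (@e2 R) *: @e2 R.
Definition corner1 : pt := corner0 - width *: @e2 R.
Definition corner2 : pt := corner0 - width *: @e1 R.

Lemma corner0E : corner0 0 0 = D (@e1 R) /\ corner0 1 0 = D (@e2 R).
Proof. by rewrite /corner0 !mxE /= !mulr1 !mulr0 addr0 add0r. Qed.

Lemma corner1E : corner1 0 0 = D (@e1 R) /\ corner1 1 0 = D (@e2 R) - width.
Proof.
by rewrite /corner1 /corner0 !mxE /=; split; ring.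
Qed.

Lemma corner2E : corner2 0 0 = D (@e1 R) - width /\ corner2 1 0 = D (@e2 R).
Proof.
by rewrite /corner2 /corner0 !mxE /=; split; ring.
Qed.

Local Notation corners := [:: corner0; corner1; corner2].

Lemma outer_point : width = 0 -> P = [set corner0].
Proof.
have [c0 c1] := corner0E; move=> w0; apply/seteqP; split => z /=.
  by move=> /outerP[z0 z1 z2]; apply: pt_eq; rewrite ?c0 ?c1; lra.
by move=> ->; apply/outerP; rewrite c0 c1; split; lra.
Qed.

Lemma corner_outer z : z \in corners -> P z.
Proof.
have w0 := width_ge0.
rewrite !inE => /or3P[]/eqP->; apply/outerP.
- by have [-> ->] := corner0E; split; lra.
- by have [-> ->] := corner1E; split; lra.
- by have [-> ->] := corner2E; split; lra.
Qed.

Section Triangle.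
Hypothesis w_gt0 : 0 < width.

Lemma corners_turn : orient corner0 corner1 corner2 < 0.
Proof.
have w0 := w_gt0; have [a0 a1] := corner0E; have [b0 b1] := corner1E.
have [c0 c1] := corner2E; rewrite /orient a0 a1 b0 b1 c0 c1.
by set w := width in w0 *; nra.
Qed.

Lemma outer_hull : P = conv_hull [set` corners].
Proof.
apply/seteqP; split; last first.
  apply: conv_hull_min; last by move=> z; exact: corner_outer.
  apply/convex_segment => x y /outerP[x0 x1 x2] /outerP[y0 y1 y2] z [t t01 ->].
  by apply/outerP; rewrite !mxE; split; nra.
have w0 := w_gt0; have [a0 a1] := corner0E; have [b0 b1] := corner1E.
have [c0 c1] := corner2E.
move=> z /outerP[z0 z1 z2].
apply: (@triangle_hull _ _ corner0 corner1 corner2).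
- by rewrite /= !inE eqxx.
- by rewrite /= !inE eqxx orbT.
- by rewrite /= !inE eqxx !orbT.
- exact: corners_turn.
- rewrite /orient a0 a1 b0 b1; nra.
- rewrite /orient c0 c1 b0 b1; nra.
- rewrite /orient a0 a1 c0 c1; nra.
Qed.

(** At each corner two of the three constraints are tight, and a tight
    constraint at an average is tight at both of the averaged points. *)
Lemma outer_vertices : vertices P = [set` corners].
Proof.
apply/seteqP; split => [z Pz|z zc].
  apply: (@vertex_generator _ _ P) => //.
  - by rewrite outer_hull; exact: conv_hull_convex.
  - by move=> y; exact: corner_outer.
  - by rewrite -outer_hull; case: Pz.
split=> [|x y t /outerP[x0 x1 x2] /outerP[y0 y1 y2] t01 zE].
  exact: corner_outer.
have z0E : z 0 0 = t * x 0 0 + (1 - t) * y 0 0 by rewrite zE !mxE.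
have z1E : z 1 0 = t * x 1 0 + (1 - t) * y 1 0 by rewrite zE !mxE.
have tight0 : z 0 0 = D (@e1 R) -> x 0 0 = y 0 0.
  by move=> zD; apply: (convex_tight t01 x0 y0); rewrite -zD.
have tight1 : z 1 0 = D (@e2 R) -> x 1 0 = y 1 0.
  by move=> zD; apply: (convex_tight t01 x1 y1); rewrite -zD.
have tight2 : - z 0 0 - z 1 0 = D (- @e1 R - @e2 R) ->
    - x 0 0 - x 1 0 = - y 0 0 - y 1 0.
  by move=> zD; apply: (convex_tight t01 x2 y2); rewrite -zD z0E z1E; ring.
move: zc; rewrite /= !inE => /or3P[]/eqP zc.
- have [a0 a1] := corner0E; rewrite zc a0 in tight0; rewrite zc a1 in tight1.
  by apply: pt_eq; [exact: tight0|exact: tight1].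
- have [b0 b1] := corner1E; rewrite zc b0 in tight0 tight2.
  have E := tight0 erefl; apply: pt_eq => //.
  by move: tight2; rewrite b1 E => /(_ _); lra.
- have [c0 c1] := corner2E; rewrite zc c1 in tight1 tight2.
  have E := tight1 erefl; apply: pt_eq => //.
  by move: tight2; rewrite c0 E => /(_ _); lra.
Qed.

Lemma corners_uniq : uniq corners.
Proof.
have w0 := w_gt0; have [a0 a1] := corner0E; have [b0 b1] := corner1E.
have [c0 c1] := corner2E.
rewrite /= !inE negb_or andbT -andbA; apply/and3P; split; apply/eqP => E.
- by move: a1; rewrite E b1; lra.
- by move: a0; rewrite E c0; lra.
- by move: b0; rewrite E c0; lra.
Qed.

Lemma corners_cw : cw corners.
Proof. by rewrite /= /turns corners_turn. Qed.

(** Each side lies on one of the supporting lines of X, which contains a vertex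
    of X, and any two corners span a side. *)
Lemma corners_touch p q : p \in corners -> q \in corners -> p != q ->
  touches X p q.
Proof.
have w0 := w_gt0; have [a0 a1] := corner0E; have [b0 b1] := corner1E.
have [c0 c1] := corner2E.
have touchC x y : touches X x y -> touches X y x.
  by case/touchesP => v Xv /segmentC; move=> ?; apply/touchesP; exists v.
have t01 : touches X corner0 corner1.
  have [v Xv] := oracle_vertex X_neq0 X_polytope D_oracle e1_neq0.
  rewrite dotp_e1 => v0; apply/touchesP; exists v => //.
  have /outerP[_ v1 v2] := sub_outer Xv.1.
  exists ((v 1 0 - (D (@e2 R) - width)) / width).
    apply/andP; split; first by rewrite divr_ge0//; lra.
    by rewrite ler_pdivrMr// mul1r; lra.
  by apply: pt_eq; rewrite coord_comb ?a0 ?a1 ?b0 ?b1 ?v0; field; lra.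
have t02 : touches X corner0 corner2.
  have [v Xv] := oracle_vertex X_neq0 X_polytope D_oracle e2_neq0.
  rewrite dotp_e2 => v1; apply/touchesP; exists v => //.
  have /outerP[v0 _ v2] := sub_outer Xv.1.
  exists ((v 0 0 - (D (@e1 R) - width)) / width).
    apply/andP; split; first by rewrite divr_ge0//; lra.
    by rewrite ler_pdivrMr// mul1r; lra.
  by apply: pt_eq; rewrite coord_comb ?a0 ?a1 ?c0 ?c1 ?v1; field; lra.
have t12 : touches X corner1 corner2.
  have [v Xv] := oracle_vertex X_neq0 X_polytope D_oracle e12_neq0.
  rewrite dotp_e12 => v2; apply/touchesP; exists v => //.
  have /outerP[v0 v1 _] := sub_outer Xv.1.
  exists ((v 0 0 - (D (@e1 R) - width)) / width).
    apply/andP; split; first by rewrite divr_ge0//; lra.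
    by rewrite ler_pdivrMr// mul1r; lra.
  apply: pt_eq; rewrite coord_comb ?b0 ?b1 ?c0 ?c1; first by field; lra.
  by rewrite -v2; field; lra.
have [t10 t20 t21] := And3 (touchC _ _ t01) (touchC _ _ t02) (touchC _ _ t12).
have memE x : x \in corners -> [\/ x = corner0, x = corner1 | x = corner2].
  by rewrite !inE => /or3P[]/eqP->; [apply: Or31|apply: Or32|apply: Or33].
by move=> /memE[]-> /memE[]->; rewrite ?eqxx // => _; assumption.
Qed.

Lemma outer_not_point : ~ exists p, P = [set p].
Proof.
move=> [p Pp]; have := corners_uniq; rewrite /= !inE negb_or -!andbA.
case/and3P => /eqP + _ _; apply.
have eqp z : z \in corners -> z = p by move=> /corner_outer; rewrite Pp.
apply: etrans (eqp _ (mem_head _ _)) _; apply/esym/eqp.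
by rewrite in_cons mem_head orbT.
Qed.

Lemma triangle_start : exists s,
  [/\ size s = 3%N, clockwise s & [set` s] = vertices P].
Proof.
exists corners; split; rewrite ?outer_vertices//.
by apply/clockwiseP; rewrite corners_uniq corners_cw.
Qed.

Lemma triangle_invariant s : size s = 3%N -> clockwise s ->
  [set` s] = vertices P -> loop_invariant X (after 1 s) 3 fset0.
Proof.
move=> s3 /(clockwise_after 1)[us cws]; rewrite outer_vertices => sE.
have mE : after 1 s =i corners.
  move=> x; rewrite mem_after.
  have h : [set` s] x <-> [set` corners] x by rewrite sE.
  by apply/idP/idP => /h.
have st : size (after 1 s) = 3%N by rewrite size_after.
have dropE : drop 3 (after 1 s) = [::] by rewrite drop_oversize ?st.
split=> //.
- move=> x /sub_outer; rewrite outer_hull; apply: conv_hull_mono => y /=.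
  by rewrite mE.
- move: st us mE; case: (after 1 s) => [|x [|y [|z [|//]]]]//= _.
  rewrite !inE negb_or andbT => /andP[/andP[xy xz] yz] mE.
  by rewrite !corners_touch -?mE ?inE ?eqxx ?orbT// eq_sym.
- by rewrite dropE; apply/fsetP => x; rewrite in_fset !inE.
- by rewrite dropE.
- by rewrite st.
- by right; rewrite st.
Qed.

End Triangle.

Lemma nv_gt0 : (0 < nv)%N.
Proof.
have [v Xv _] := vertex_max X_polytope X_neq0 e1_neq0.
by apply: (@card_known _ X nv X_nv [:: v]) => // x; rewrite inE => /eqP ->.
Qed.

(** A single vertex p attains the three maxima, and the three directions add up
    to 0. *)
Lemma one_vertex_width : nv = 1%N -> width = 0.
Proof.
move=> nv1.
have [v Xv vD] := oracle_vertex X_neq0 X_polytope D_oracle e1_neq0.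
have [w Xw wD] := oracle_vertex X_neq0 X_polytope D_oracle e2_neq0.
have [u Xu uD] := oracle_vertex X_neq0 X_polytope D_oracle e12_neq0.
have same x : vertices X x -> x = v.
  move=> Xx; apply/eqP; apply: contraT => xv.
  have := @card_known _ X nv X_nv [:: x; v].
  rewrite /= inE xv nv1 => /(_ isT); apply.
  by move=> y; rewrite !inE => /orP[]/eqP->.
rewrite -vD -wD -uD (same w)// (same u)//.
by rewrite dotp_e1 dotp_e2 dotp_e12; lra.
Qed.

Lemma point_outcome p K : P = [set p] -> (3 <= K)%N ->
  outcome X K [fset p]%fset 3.
Proof.
move=> Pp K3; split=> //.
have Xp x : X x -> x = p by move=> /sub_outer; rewrite Pp.
have [v Xv _] := vertex_max X_polytope X_neq0 e1_neq0.
have vp : v = p by apply: Xp; case: Xv.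
apply/seteqP; split=> x /=; rewrite in_fset1.
  by move=> /eqP ->; rewrite -vp.
by case=> /Xp ->.
Qed.

Lemma start_halts :
  halts_with D nf (outcome X (3 * nv + slack nv nf - 1)) Start.
Proof.
have nv0 := nv_gt0; have sl := slack12 nv nf.
have K3 : (3 <= 3 * nv + slack nv nf - 1)%N by move: nv0 sl; lia.
apply: halts_later.
  have [w0|w0] := eqVneq width 0.
    exists (Halt [fset corner0]%fset 3); apply: step_init_point.
    exact: outer_point.
  have w_gt0 : 0 < width by rewrite lt_neqAle eq_sym w0 width_ge0.
  have [s [s3 cs sE]] := triangle_start w_gt0.
  exists (Loop s 1 fset0 3); apply: step_init_triangle => //.
  exact: outer_not_point.
move=> st h; inversion h as [p Pp|s np s3 cs sE| | | | |]; subst.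
  exact/halts_now/point_outcome.
have w_gt0 : 0 < width.
  rewrite lt_neqAle width_ge0 andbT eq_sym; apply/eqP => w0.
  by apply: np; exists corner0; exact: outer_point.
have inv := triangle_invariant w_gt0 s3 cs sE.
apply: (loop_halts X_neq0 X_polytope X_nv D_oracle nf_ge
  (n := 3 * nv) _ inv) => //.
  by rewrite s3 /budget /=; move: nv0 sl; lia.
by rewrite s3; move: nv0; lia.
Qed.

Lemma one_vertex_halts : nv = 1%N -> halts_at_init D nf.
Proof.
move=> nv1; have Pp := outer_point (one_vertex_width nv1).
split; first by exists (Halt [fset corner0]%fset 3); exact: step_init_point.
move=> st h; inversion h as [p Pp'|s np s3 cs sE| | | | |]; subst.
  by exists [fset p]%fset, 3%N.
by case: np; exists corner0.
Qed.

End Start.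

Theorem theorem3p3 (R : realType) (X : set 'cV[R]_2) (D : 'cV[R]_2 -> R)
    (nv : nat) (nf : option nat)
    (X_neq0 : X !=set0) (X_compact : compact X) (X_polytope : polytope X)
    (X_nv : vertices X #= `I_nv) (D_oracle : is_oracle X D)
    (nf_ge : bound_ge nf nv) :
  [/\ nv = 1%N -> halts_at_init D nf,
      nf = Some nv -> halts_with D nf (fun _ k => (k <= 3 * nv)%N) Start,
      bound_gt nf nv -> halts_with D nf (fun _ k => (k <= 3 * nv + 1)%N) Start
    & halts_with D nf (fun S _ => [set` S] = vertices X) Start].
Proof.
have halts := start_halts X_neq0 X_polytope X_nv D_oracle nf_ge.
split.
- exact: (one_vertex_halts X_neq0 X_polytope X_nv D_oracle nf_ge).
- move=> nfE; apply: halts_with_weaken halts => S k [_].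
  by rewrite /slack nfE eqxx addnK.
- move=> _; apply: halts_with_weaken halts => S k [_ /leq_trans]; apply.
  by have := slack12 nv nf; lia.
- by apply: halts_with_weaken halts => S k [].
Qed.
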